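(* Let $\mathcal{A}$ be a metabelian Lie algebra over $\mathbf{k}$ with $\mathbf{k}$-basis $Y=\{a_i\mid i\in I\}\cup\{b_j\mid j\in J\}$, where $\{a_i\}$ is a basis of $\mathcal{A}^{(1)}$, the $b_j$ are linearly independent modulo $\mathcal{A}^{(1)}$, and $I,J$ are well-ordered sets. Let $M$ be the set consisting of the polynomials $$m_{1ij}=a_ib_j-\sum_k\gamma_{ij}^ka_k,\qquad m_{2ij}=b_ib_j-\sum_k\delta_{ij}^ka_k\ (i>j),\qquad m_{3ij}=a_ia_j\ (i>j),$$ where $\gamma_{ij}^k,\delta_{ij}^k\in\mathbf{k}$ are the structure constants of $\mathcal{A}$ in the basis $Y$ (so $\mathcal{A}=\mathcal{L}_{(2)}(Y|M)$). Let $X=\{x_h\mid h\in H\}$ be a well-ordered set, disjoint from $Y$, and let $\mathcal{S}=\mathcal{A}*\mathcal{L}_{(2)}(X)=\mathcal{L}_{(2)}(X\cup Y|M)$ be the free metabelian Lie product of $\mathcal{A}$ and $\mathcal{L}_{(2)}(X)$. Order $X\cup Y$ so that $x_h>a_i>b_j$ for all $h,i,j$. Then a Gröbner–Shirshov complement $M^C$ of $M$ in $\mathcal{L}_{(2)}(X\cup Y)$ consists of $M$ and some $X$-homogeneous polynomials $f$ without $(0)$-part (i.e. $f^{(0)}=0$) whose leading words are of the form $xy\cdots$ with $x\in X$, $y\in Y$, and contain some $a_i$ as a strict subword.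
   Context: $\mathbf{k}$ is a field of arbitrary characteristic. For a well-ordered set $Z$, $\mathcal{L}_{(2)}(Z)=Lie(Z)/Lie(Z)^{(2)}$ is the free metabelian Lie algebra over $\mathbf{k}$ on $Z$, where $\mathcal{L}^{(0)}=\mathcal{L}$, $\mathcal{L}^{(n+1)}=[\mathcal{L}^{(n)},\mathcal{L}^{(n)}]$ (metabelian means $\mathcal{L}^{(2)}=0$); $\mathcal{L}_{(2)}(Z|S)=\mathcal{L}_{(2)}(Z)/Id(S)$, where $Id(S)$ is the ideal generated by $S$. The Lie product is written $uv$ or $u\cdot v$; products without brackets are left-normed. In $X\cup Y$ the $x_h$, the $a_i$ and the $b_j$ are ordered among themselves by the well-orders of their index sets. A polynomial is called $X$-homogeneous if all words occurring in it have the same degree in the letters from $X$ (number of letters from $X$ counted with multiplicity). Words (stated for a well-ordered set $Z$). $[Z]$ is the free commutative monoid on $Z$; $\langle c_{1}\cdots c_{m}\rangle$ denotes the letters $c_1,\dots,c_m$ rearranged in non-decreasing order. $R=\{c_0c_1\cdots c_n \mid n\ge1,\ c_i\in Z,\ c_0>c_1\le c_2\le\cdots\le c_n\}$ and $N=Z\cup R$ (regular words), a $\mathbf{k}$-basis of $\mathcal{L}_{(2)}(Z)$. The strict subwords of $c_0c_1\cdots c_n\in R$ are the letters $c_i$ with $2\le i\le n$, and also $c_1$ if $c_0>c_2$. Each $f$ is uniquely $f=f^{(1)}+f^{(0)}$, $f^{(1)}\in\mathbf{k}R$, $f^{(0)}\in\mathbf{k}Z$. Length: $|c|=1$ for $c\in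 Z$, $|c_0c_1\cdots c_n|=n+1$. $N$ is ordered degree-lexicographically (first by length, then lexicographically). For $f\ne0$, $\bar f$ is the largest word occurring in $f$ with nonzero coefficient (leading word); $f$ is monic if the coefficient of $\bar f$ is $1$. Conditions mentioning $\bar h$ presuppose $h\ne0$. Normal $S$-words: (i) $sc_1c_2\cdots c_n$ with $s\in S$, $n\ge0$, $c_i\in Z$, $c_1\le\cdots\le c_n$, $\bar s\ne c_1$ (no condition on letters if $n=0$); (ii) $us$ with $u\in R$, $s\in S$, $\bar s\neq u$. Compositions. Let $f,g$ be monic, $\alpha,\beta$ the coefficients of $\overline{f^{(0)}}$, $\overline{g^{(0)}}$ in $f$, $g$; letters $c_i,d_i,c,d\in Z$. $f\langle e_1\cdots e_r\rangle$ is the left-normed product of $f$ by the letters in non-decreasing order; a hat means omission. Type I: $\bar f=c_0c_1\cdots c_n$, $\bar g=c_0d_1\cdots d_m$ ($n,m\ge0$), $L$ the least common multiple in $[Z]$ of $c_1\cdots c_n$ and $d_1\cdots d_m$, $w=c_0\langle L\rangle$: $C_I(f,g)_w=f\langle L/(c_1\cdots c_n)\rangle-g\langle L/(d_1\cdots d_m)\rangle$. Type II: $\bar f=\overline{f^{(1)}}=c_0c_1\cdots c_n$, and $\overline{g^{(0)}}=c_i$ for some $i\ge2$, or $\overline{g^{(0)}}=c_1$ (put $i=1$) and $c_0>c_2$; $w=\bar f$: $C_{II}(f,g)_w=f-\beta^{-1}c_0c_1\cdots\hat{c_i}\cdots c_n\cdot g$. Type III: $\bar f=\overline{f^{(1)}}=c_0c_1\cdots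 c_n$, $\bar g=\overline{g^{(0)}}=c_1$, and $c_0\le c_2$ or $n=1$; $w=\bar f$: $C_{III}(f,g)_w=f+gc_0c_2\cdots c_n$. Type IV: $\bar f=\overline{f^{(1)}}=c_0c_1\cdots c_n$, $g^{(1)}\ne0$, $\overline{g^{(0)}}=c_1$, and $c_0\le c_2$ or $n=1$; for any letter $c<c_0$, $w=c_0\langle c_1\cdots c_nc\rangle$: $C_{IV}(f,g)_w=fc-\beta^{-1}c_0cc_2\cdots c_n\cdot g$. Type V: $\bar f=\overline{f^{(1)}}=c_0c_1\cdots c_n$, $f^{(0)}\ne0$, $g^{(1)}\ne0$, $\overline{g^{(0)}}=d\notin\{c_i\}_{i=1}^n$; $w=c_0\langle c_1\cdots c_nd\rangle$: $C_V(f,g)_w=fd-\beta^{-1}c_0c_1\cdots c_n\cdot g$. Type VI: $\overline{f^{(0)}}=\overline{g^{(0)}}=c$, $f^{(1)}\ne0$; for any $c_0c_1\in R$, $w=c_0\langle c_1c\rangle$: $C_{VI}(f,g)_w=(c_0c_1)(\alpha^{-1}f-\beta^{-1}g)$. Type VII: $f^{(1)}\ne0$, $g^{(1)}\ne0$, $\overline{f^{(0)}}=c>\overline{g^{(0)}}=d$; for any letter $c_0>c$, $w=c_0dc$: $C_{VII}(f,g)_w=\alpha^{-1}(c_0d)f-\beta^{-1}(c_0c)g$. Triviality: for a set $S$ of monic polynomials and $w\in N$, $f\equiv0\ mod(S,w)$ means that $f$ is a $\mathbf{k}$-linear combination of normal $S$-words $u_s$ with $\overline{u_s}<w$. $S$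 is a Gröbner–Shirshov basis if $C_\lambda(f,g)_w\equiv0\ mod(S,w)$ for all $f,g\in S$ and all compositions. A Gröbner–Shirshov complement $S^C$ of $S$ is a Gröbner–Shirshov basis generating the same ideal as $S$, obtained from $S$ by repeatedly adding nontrivial compositions (Shirshov's algorithm); added polynomials may be normalized to be monic and replaced by their remainders modulo normal words of the polynomials already present with smaller leading words than $w$. *)

(* Defs.v *)
From HB Require Import structures.
From mathcomp Require Import all_boot all_order all_algebra.
From mathcomp Require Import finmap multiset.
From mathcomp Require Import boolp classical_sets functions cardinality fsbigop
  wochoice.

Set Implicit Arguments.
Unset Strict Implicit.
Unset Printing Implicit Defensive.

Import Order.TTheory GRing.Theory.

Local Open Scope classical_set_scope.
Local Open Scope ring_scope.
Local Open Scope quotient_scope.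

HB.mixin Record Lmodule_isLie (k : fieldType) L of GRing.Lmodule k L := {
  lie : L -> L -> L;
  lieDl : forall u v w, lie (u + v) w = lie u w + lie v w;
  lieDr : forall u v w, lie u (v + w) = lie u v + lie u w;
  lieZl : forall (c : k) u v, lie (c *: u) v = c *: lie u v;
  lieZr : forall (c : k) u v, lie u (c *: v) = c *: lie u v;
  lie_alt : forall u, lie u u = 0;
  lie_jacobi : forall u v w,
    lie (lie u v) w + lie (lie v w) u + lie (lie w u) v = 0
}.

#[short(type="lieAlgType")]
HB.structure Definition LieAlgebra (k : fieldType) :=
  { L of Lmodule_isLie k L & GRing.Lmodule k L }.

Section LinearCombinations.
Variables (k : fieldType) (V : lmodType k).

Definition fin_supp (T : choiceType) (p : T -> k) : Prop :=
  finite_set [set t | p t != 0].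

(* Only meaningful when [p] has finite support. *)
Definition lincomb (T : choiceType) (e : T -> V) (p : T -> k) : V :=
  \sum_(t \in [set: T]) p t *: e t.

Definition lin_span (P : set V) : set V :=
  [set v | exists2 s : seq (k * V),
     (forall c, c \in s -> P c.2) & v = \sum_(c <- s) c.1 *: c.2].

Definition lin_indep_mod (W : set V) (T : choiceType) (e : T -> V) : Prop :=
  forall p : T -> k, fin_supp p -> W (lincomb e p) -> forall t, p t = 0.

Definition is_basis (W : set V) (T : choiceType) (e : T -> V) : Prop :=
  lin_indep_mod [set 0] e /\ lin_span (range e) = W.

(* The coordinates of [v] in the family [e]; only meaningful when [e] is
   linearly independent and [v] lies in its span. *)
Definition coords (T : choiceType) (e : T -> V) (v : V) : T -> k :=
  xget (fun=> 0) [set p | fin_supp p /\ v = lincomb e p].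

End LinearCombinations.

Section LieAlgebras.
Variables (k : fieldType) (L : lieAlgType k).

Definition lie_ideal (J : set L) : Prop :=
  [/\ J 0, (forall u v, J u -> J v -> J (u + v)),
      (forall (c : k) u, J u -> J (c *: u)) &
      forall u v, J u -> J (lie u v) /\ J (lie v u)].

Definition ideal_gen (S : set L) : set L :=
  [set u | forall J : set L, lie_ideal J -> S `<=` J -> J u].

Fixpoint derived (n : nat) : set L :=
  if n is m.+1 then
    lin_span [set w | exists u v, [/\ derived m u, derived m v & w = lie u v]]
  else [set: L].

Definition metabelian : Prop := derived 2 = [set 0].

Lemma ideal_gen_ideal (S : set L) : lie_ideal (ideal_gen S).
Proof.
split.
- by move=> J [].
- by move=> u v hu hv J hJ hS; case: (hJ) => _ hD _ _;
    apply: hD; [exact: hu | exact: hv].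
- by move=> c u hu J hJ hS; case: (hJ) => _ _ hZ _; apply: hZ; exact: hu.
- by move=> u v hu; split=> J hJ hS; case: (hJ) => _ _ _ hM;
    case: (hM u v (hu J hJ hS)).
Qed.

End LieAlgebras.

Section LieQuotient.
Variables (k : fieldType) (L : lieAlgType k) (S : set L).

Local Fact IdD u v : ideal_gen S u -> ideal_gen S v -> ideal_gen S (u + v).
Proof. by case: (ideal_gen_ideal S) => _ h _ _; apply: h. Qed.
Local Fact IdZ (c : k) u : ideal_gen S u -> ideal_gen S (c *: u).
Proof. by case: (ideal_gen_ideal S) => _ _ h _; apply: h. Qed.
Local Fact IdMl u v : ideal_gen S u -> ideal_gen S (lie u v).
Proof. by case: (ideal_gen_ideal S) => _ _ _ h hu; case: (h u v hu). Qed.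
Local Fact IdMr u v : ideal_gen S u -> ideal_gen S (lie v u).
Proof. by case: (ideal_gen_ideal S) => _ _ _ h hu; case: (h u v hu). Qed.

Definition lie_quot_rel : rel L := fun u v => `[< ideal_gen S (u - v) >].

Lemma lie_quot_rel_equiv : equiv_class_of lie_quot_rel.
Proof.
have sym u v : ideal_gen S (u - v) -> ideal_gen S (v - u).
  by move=> /(IdZ (-1)); rewrite scaleN1r opprB.
split=> [u|u v|v u w].
- by apply/asboolP; rewrite subrr; case: (ideal_gen_ideal S).
- by apply/idP/idP => /asboolP huv; apply/asboolP; exact: sym.
- by move=> /asboolP h1 /asboolP h2; apply/asboolP;
    rewrite -(subrKA v); apply: IdD.
Qed.

Canonical lie_quot_equiv := EquivRelPack lie_quot_rel_equiv.

(* L / Id(S) *)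
Definition lie_quot : Type := {eq_quot lie_quot_equiv}.

HB.instance Definition _ := Choice.on lie_quot.

Definition lie_proj (u : L) : lie_quot := \pi_{eq_quot lie_quot_equiv} u.
Local Definition rp (x : lie_quot) : L := repr (x : {eq_quot lie_quot_equiv}).

Local Fact rpK x : lie_proj (rp x) = x.
Proof. exact: reprK. Qed.

Lemma lie_projP u v : lie_proj u = lie_proj v <-> ideal_gen S (u - v).
Proof. by split=> [/eqmodP/asboolP|h] //; apply/eqmodP/asboolP. Qed.

Local Fact rpP u : ideal_gen S (rp (lie_proj u) - u).
Proof. by apply/lie_projP; rewrite rpK. Qed.

Local Definition qadd x y := lie_proj (rp x + rp y).
Local Definition qopp x := lie_proj (- rp x).
Local Definition qscale (c : k) x := lie_proj (c *: rp x).
Local Definition qlie x y := lie_proj (lie (rp x) (rp y)).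

Local Fact qaddE u v : qadd (lie_proj u) (lie_proj v) = lie_proj (u + v).
Proof. by apply/lie_projP; rewrite opprD addrACA; apply: IdD; apply: rpP. Qed.
Local Fact qoppE u : qopp (lie_proj u) = lie_proj (- u).
Proof. by apply/lie_projP; rewrite -opprD -scaleN1r; apply: IdZ; exact: rpP. Qed.
Local Fact qscaleE c u : qscale c (lie_proj u) = lie_proj (c *: u).
Proof. by apply/lie_projP; rewrite -scalerBr; apply: IdZ; exact: rpP. Qed.
Local Fact qlieE u v : qlie (lie_proj u) (lie_proj v) = lie_proj (lie u v).
Proof.
apply/lie_projP; rewrite -(subrKA (lie u (rp (lie_proj v)))).
apply: IdD.
  by rewrite -scaleN1r -lieZl -lieDl scaleN1r; apply: IdMl; exact: rpP.
by rewrite -scaleN1r -lieZr -lieDr scaleN1r; apply: IdMr; exact: rpP.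
Qed.

Local Fact qaddA : associative qadd.
Proof. by move=> x y z; rewrite -[x]rpK -[y]rpK -[z]rpK !qaddE addrA. Qed.
Local Fact qaddC : commutative qadd.
Proof. by move=> x y; rewrite -[x]rpK -[y]rpK !qaddE addrC. Qed.
Local Fact qadd0 : left_id (lie_proj 0) qadd.
Proof. by move=> x; rewrite -[x]rpK !qaddE add0r. Qed.
Local Fact qaddN : left_inverse (lie_proj 0) qopp qadd.
Proof. by move=> x; rewrite -[x]rpK qoppE !qaddE addNr. Qed.

HB.instance Definition _ :=
  GRing.isZmodule.Build lie_quot qaddA qaddC qadd0 qaddN.

Local Fact qD x y : x + y = qadd x y. Proof. by []. Qed.

Local Fact qscaleA c d x : qscale c (qscale d x) = qscale (c * d) x.
Proof. by rewrite -[x]rpK !qscaleE scalerA. Qed.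
Local Fact qscale1 : left_id 1 qscale.
Proof. by move=> x; rewrite -[x]rpK !qscaleE scale1r. Qed.
Local Fact qscaleDr : right_distributive qscale +%R.
Proof.
by move=> c x y; rewrite -[x]rpK -[y]rpK !qD !(qaddE, qscaleE) scalerDr.
Qed.
Local Fact qscaleDl x : {morph qscale^~ x : c d / c + d}.
Proof.
by move=> c d; rewrite -[x]rpK !qD !qscaleE qaddE scalerDl.
Qed.

HB.instance Definition _ :=
  GRing.Zmodule_isLmodule.Build k lie_quot qscaleA qscale1 qscaleDr qscaleDl.

Fact lie_projD u v : lie_proj (u + v) = lie_proj u + lie_proj v.
Proof. by rewrite qD qaddE. Qed.
Fact lie_projZ c u : lie_proj (c *: u) = c *: lie_proj u.
Proof. by rewrite -qscaleE. Qed.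
Fact lie_proj0 : lie_proj 0 = 0. Proof. by []. Qed.

Local Fact qlieDl x y z : qlie (x + y) z = qlie x z + qlie y z.
Proof. by rewrite -[x]rpK -[y]rpK -[z]rpK -lie_projD !qlieE lieDl lie_projD. Qed.
Local Fact qlieDr x y z : qlie x (y + z) = qlie x y + qlie x z.
Proof. by rewrite -[x]rpK -[y]rpK -[z]rpK -lie_projD !qlieE lieDr lie_projD. Qed.
Local Fact qlieZl c x y : qlie (c *: x) y = c *: qlie x y.
Proof. by rewrite -[x]rpK -[y]rpK -lie_projZ !qlieE lieZl lie_projZ. Qed.
Local Fact qlieZr c x y : qlie x (c *: y) = c *: qlie x y.
Proof. by rewrite -[x]rpK -[y]rpK -lie_projZ !qlieE lieZr lie_projZ. Qed.
Local Fact qlie_alt x : qlie x x = 0.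
Proof. by rewrite -[x]rpK qlieE lie_alt lie_proj0. Qed.
Local Fact qlie_jacobi x y z :
  qlie (qlie x y) z + qlie (qlie y z) x + qlie (qlie z x) y = 0.
Proof.
by rewrite -[x]rpK -[y]rpK -[z]rpK !qlieE -!lie_projD lie_jacobi lie_proj0.
Qed.

HB.instance Definition _ := Lmodule_isLie.Build k lie_quot
  qlieDl qlieDr qlieZl qlieZr qlie_alt qlie_jacobi.

Fact lie_projM u v : lie_proj (lie u v) = lie (lie_proj u) (lie_proj v).
Proof. by rewrite -qlieE. Qed.

End LieQuotient.

Inductive lie_term (k Z : Type) : Type :=
| LVar of Z
| LZero
| LAdd of lie_term k Z & lie_term k Z
| LScale of k & lie_term k Z
| LMul of lie_term k Z & lie_term k Z.
Arguments LVar {k Z}.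
Arguments LZero {k Z}.

HB.instance Definition _ (k Z : Type) := gen_eqMixin (lie_term k Z).
HB.instance Definition _ (k Z : Type) := gen_choiceMixin (lie_term k Z).

Section FreeLie.
Variables (k : fieldType) (Z : Type).
Implicit Types r s t : lie_term k Z.

(* The least congruence containing the axioms of Lie algebras over [k]. *)
Inductive lie_cong : lie_term k Z -> lie_term k Z -> Prop :=
| LCrefl t : lie_cong t t
| LCsym s t : lie_cong s t -> lie_cong t s
| LCtrans r s t : lie_cong r s -> lie_cong s t -> lie_cong r t
| LCadd s s' t t' :
    lie_cong s s' -> lie_cong t t' -> lie_cong (LAdd s t) (LAdd s' t')
| LCscale c t t' : lie_cong t t' -> lie_cong (LScale c t) (LScale c t')
| LCmul s s' t t' :
    lie_cong s s' -> lie_cong t t' -> lie_cong (LMul s t) (LMul s' t')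
| LCaddA r s t : lie_cong (LAdd r (LAdd s t)) (LAdd (LAdd r s) t)
| LCaddC s t : lie_cong (LAdd s t) (LAdd t s)
| LCadd0 t : lie_cong (LAdd LZero t) t
| LCaddN t : lie_cong (LAdd (LScale (-1) t) t) LZero
| LCscaleA c d t : lie_cong (LScale c (LScale d t)) (LScale (c * d) t)
| LCscale1 t : lie_cong (LScale 1 t) t
| LCscaleDr c s t :
    lie_cong (LScale c (LAdd s t)) (LAdd (LScale c s) (LScale c t))
| LCscaleDl c d t :
    lie_cong (LScale (c + d) t) (LAdd (LScale c t) (LScale d t))
| LCmulDl r s t : lie_cong (LMul (LAdd r s) t) (LAdd (LMul r t) (LMul s t))
| LCmulDr r s t : lie_cong (LMul r (LAdd s t)) (LAdd (LMul r s) (LMul r t))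
| LCmulZl c s t : lie_cong (LMul (LScale c s) t) (LScale c (LMul s t))
| LCmulZr c s t : lie_cong (LMul s (LScale c t)) (LScale c (LMul s t))
| LCalt t : lie_cong (LMul t t) LZero
| LCjacobi r s t :
    lie_cong
      (LAdd (LAdd (LMul (LMul r s) t) (LMul (LMul s t) r)) (LMul (LMul t r) s))
      LZero.

Definition lie_cong_rel : rel (lie_term k Z) := fun s t => `[< lie_cong s t >].

Lemma lie_cong_equiv : equiv_class_of lie_cong_rel.
Proof.
split=> [t|s t|s r t].
- by apply/asboolP; exact: LCrefl.
- by apply/idP/idP => /asboolP hst; apply/asboolP; exact: LCsym.
- by move=> /asboolP h1 /asboolP h2; apply/asboolP; exact: LCtrans h1 h2.
Qed.

Canonical lie_cong_equivRel := EquivRelPack lie_cong_equiv.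

(* Lie(Z) *)
Definition free_lie : Type := {eq_quot lie_cong_equivRel}.

HB.instance Definition _ := Choice.on free_lie.

Local Definition cl t : free_lie := \pi_{eq_quot lie_cong_equivRel} t.
Local Definition frp (x : free_lie) : lie_term k Z :=
  repr (x : {eq_quot lie_cong_equivRel}).

Local Fact frpK x : cl (frp x) = x. Proof. exact: reprK. Qed.

Local Fact clP s t : cl s = cl t <-> lie_cong s t.
Proof. by split=> [/eqmodP/asboolP|h] //; apply/eqmodP/asboolP. Qed.

Local Fact frpP t : lie_cong (frp (cl t)) t.
Proof. by apply/clP; rewrite frpK. Qed.

Local Definition fadd x y := cl (LAdd (frp x) (frp y)).
Local Definition fscale (c : k) x := cl (LScale c (frp x)).
Local Definition fopp x := fscale (-1) x.
Local Definition flie x y := cl (LMul (frp x) (frp y)).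

Local Fact faddE s t : fadd (cl s) (cl t) = cl (LAdd s t).
Proof. by apply/clP/LCadd; apply: frpP. Qed.
Local Fact fscaleE c t : fscale c (cl t) = cl (LScale c t).
Proof. by apply/clP/LCscale; apply: frpP. Qed.
Local Fact flieE s t : flie (cl s) (cl t) = cl (LMul s t).
Proof. by apply/clP/LCmul; apply: frpP. Qed.

Local Fact faddA : associative fadd.
Proof.
by move=> x y z; rewrite -[x]frpK -[y]frpK -[z]frpK !faddE; apply/clP/LCaddA.
Qed.
Local Fact faddC : commutative fadd.
Proof. by move=> x y; rewrite -[x]frpK -[y]frpK !faddE; apply/clP/LCaddC. Qed.
Local Fact fadd0 : left_id (cl LZero) fadd.
Proof. by move=> x; rewrite -[x]frpK !faddE; apply/clP/LCadd0. Qed.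
Local Fact faddN : left_inverse (cl LZero) fopp fadd.
Proof.
by move=> x; rewrite -[x]frpK /fopp fscaleE !faddE; apply/clP/LCaddN.
Qed.

HB.instance Definition _ :=
  GRing.isZmodule.Build free_lie faddA faddC fadd0 faddN.

Local Fact fD x y : x + y = fadd x y. Proof. by []. Qed.

Local Fact fscaleA c d x : fscale c (fscale d x) = fscale (c * d) x.
Proof. by rewrite -[x]frpK !fscaleE; apply/clP/LCscaleA. Qed.
Local Fact fscale1 : left_id 1 fscale.
Proof. by move=> x; rewrite -[x]frpK !fscaleE; apply/clP/LCscale1. Qed.
Local Fact fscaleDr : right_distributive fscale +%R.
Proof.
move=> c x y; rewrite -[x]frpK -[y]frpK !fD !(faddE, fscaleE).
exact/clP/LCscaleDr.
Qed.
Local Fact fscaleDl x : {morph fscale^~ x : c d / c + d}.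
Proof.
by move=> c d; rewrite -[x]frpK !fD !fscaleE faddE; apply/clP/LCscaleDl.
Qed.

HB.instance Definition _ :=
  GRing.Zmodule_isLmodule.Build k free_lie fscaleA fscale1 fscaleDr fscaleDl.

Local Fact fZ c x : c *: x = fscale c x. Proof. by []. Qed.

Local Fact flieDl x y z : flie (x + y) z = flie x z + flie y z.
Proof.
rewrite -[x]frpK -[y]frpK -[z]frpK !fD !(faddE, flieE).
exact/clP/LCmulDl.
Qed.
Local Fact flieDr x y z : flie x (y + z) = flie x y + flie x z.
Proof.
rewrite -[x]frpK -[y]frpK -[z]frpK !fD !(faddE, flieE).
exact/clP/LCmulDr.
Qed.
Local Fact flieZl c x y : flie (c *: x) y = c *: flie x y.
Proof.
by rewrite -[x]frpK -[y]frpK !fZ !(fscaleE, flieE); apply/clP/LCmulZl.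
Qed.
Local Fact flieZr c x y : flie x (c *: y) = c *: flie x y.
Proof.
by rewrite -[x]frpK -[y]frpK !fZ !(fscaleE, flieE); apply/clP/LCmulZr.
Qed.
Local Fact flie_alt x : flie x x = 0.
Proof. by rewrite -[x]frpK flieE; apply/clP/LCalt. Qed.
Local Fact flie_jacobi x y z :
  flie (flie x y) z + flie (flie y z) x + flie (flie z x) y = 0.
Proof.
rewrite -[x]frpK -[y]frpK -[z]frpK !flieE !fD !faddE.
exact/clP/LCjacobi.
Qed.

HB.instance Definition _ := Lmodule_isLie.Build k free_lie
  flieDl flieDr flieZl flieZr flie_alt flie_jacobi.

Definition free_gen (z : Z) : free_lie := cl (LVar z).

End FreeLie.

(* Lie(Z) / Lie(Z)^(2); as Lie(Z)^(2) is an ideal, it is the ideal it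
   generates. *)
Definition free_metab (k : fieldType) (Z : Type) : Type :=
  lie_quot (@derived k (free_lie k Z) 2).

HB.instance Definition _ (k : fieldType) (Z : Type) :=
  LieAlgebra.on (free_metab k Z).

Definition gen (k : fieldType) (Z : Type) (z : Z) : free_metab k Z :=
  lie_proj _ (free_gen k z).

Section Words.
Variables (d : Order.disp_t) (Z : orderType d).

Definition regular_word (s : seq Z) : bool :=
  match s with
  | [::] => false
  | [:: _] => true
  | c0 :: c1 :: cs => (c1 < c0)%O && sorted <=%O (c1 :: cs)
  end.

(* N = Z ∪ R; the elements of R are the words of length at least 2. *)
Record word : Type := Word { wseq :> seq Z; wseqP : regular_word wseq }.

HB.instance Definition _ := [isSub for wseq].
HB.instance Definition _ := [Choice of word by <:].

Definition word_lt (u v : seq Z) : bool :=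
  (size u < size v)%N
  || ((size u == size v) && ((u : seqlexi Z) < (v : seqlexi Z))%O).

Definition strict_subword (c : Z) (s : seq Z) : bool :=
  if s is c0 :: c1 :: cs then
    (c \in cs) || ((c == c1) && (if cs is c2 :: _ then (c2 < c0)%O else false))
  else false.

(* The non-decreasing rearrangement of a commutative monomial. *)
Definition sorted_letters (m : multiset Z) : seq Z := sort <=%O (m : seq Z).

End Words.

Section GroebnerShirshov.
Variables (k : fieldType) (d : Order.disp_t) (Z : orderType d).

Local Notation L := (free_metab k Z).
Local Notation x_ := (@gen k Z).
Implicit Types (f g h : L) (S : set L) (u w : seq Z).

(* Left-normed product f c_1 ... c_n. *)
Definition lnprod f (cs : seq Z) : L := foldl (fun v c => lie v (x_ c)) f cs.

(* The left-normed product of the letters of a nonempty word. *)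
Definition wprod u : L := if u is c :: cs then lnprod (x_ c) cs else 0.

Definition coef f : word Z -> k := coords (fun v : word Z => wprod v) f.

Definition part1 f : L :=
  lincomb (fun v : word Z => wprod v)
    (fun v => if (1 < size v)%N then coef f v else 0).

Definition part0 f : L :=
  lincomb (fun v : word Z => wprod v)
    (fun v => if (size v == 1)%N then coef f v else 0).

(* f is nonzero, its leading word is u, and u has coefficient alpha in f. *)
Definition leading f (alpha : k) u : Prop :=
  exists v : word Z,
    [/\ wseq v = u, coef f v = alpha, alpha != 0 &
        forall v' : word Z, coef f v' != 0 -> v' != v -> word_lt v' v].

Definition leading_word f u : Prop := exists alpha, leading f alpha u.

Definition monic f : Prop := exists u, leading f 1 u.

Inductive normal_word S : L -> Prop :=
| NormalL f cs :
    S f -> sorted <=%O cs ->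
    (if cs is c1 :: _ then ~ leading_word f [:: c1] else True) ->
    normal_word S (lnprod f cs)
| NormalR (u : word Z) f :
    (1 < size u)%N -> S f -> ~ leading_word f u ->
    normal_word S (lie (wprod u) f).

Definition normal_below S w : set L :=
  [set v | normal_word S v /\ exists2 u, leading_word v u & word_lt u w].

Definition trivial_mod S w : set L := lin_span (normal_below S w).

(* [composition f g w h]: h = C(f,g)_w for one of the seven types, f and g
   being monic.  A leading word of length at least 2 is the leading word of
   the (1)-part, and one of length 1 is the leading word of the (0)-part. *)
Inductive composition f g : seq Z -> L -> Prop :=
| CompI c0 cs ds (l := (seq_mset cs `|` seq_mset ds)%mset) :
    leading f 1 (c0 :: cs) -> leading g 1 (c0 :: ds) ->
    composition f g (c0 :: sorted_letters l)
      (lnprod f (sorted_letters (l `\` seq_mset cs)%mset)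
       - lnprod g (sorted_letters (l `\` seq_mset ds)%mset))
| CompII c0 c1 cs c es beta :
    leading f 1 (c0 :: c1 :: cs ++ c :: es) ->
    leading (part0 g) beta [:: c] ->
    composition f g (c0 :: c1 :: cs ++ c :: es)
      (f - beta^-1 *: lie (wprod (c0 :: c1 :: cs ++ es)) g)
| CompII1 c0 c1 c2 cs beta :
    leading f 1 (c0 :: c1 :: c2 :: cs) ->
    leading (part0 g) beta [:: c1] -> (c2 < c0)%O ->
    composition f g (c0 :: c1 :: c2 :: cs)
      (f - beta^-1 *: lie (wprod (c0 :: c2 :: cs)) g)
| CompIII c0 c1 cs :
    leading f 1 (c0 :: c1 :: cs) -> leading g 1 [:: c1] ->
    (if cs is c2 :: _ then (c0 <= c2)%O else true) ->
    composition f g (c0 :: c1 :: cs) (f + lnprod g (c0 :: cs))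
| CompIV c0 c1 cs beta c :
    leading f 1 (c0 :: c1 :: cs) -> part1 g != 0 ->
    leading (part0 g) beta [:: c1] ->
    (if cs is c2 :: _ then (c0 <= c2)%O else true) ->
    (c < c0)%O ->
    composition f g (c0 :: sort <=%O (c :: c1 :: cs))
      (lie f (x_ c) - beta^-1 *: lie (wprod (c0 :: c :: cs)) g)
| CompV c0 c1 cs beta e :
    leading f 1 (c0 :: c1 :: cs) -> part0 f != 0 -> part1 g != 0 ->
    leading (part0 g) beta [:: e] -> e \notin c1 :: cs ->
    composition f g (c0 :: sort <=%O (e :: c1 :: cs))
      (lie f (x_ e) - beta^-1 *: lie (wprod (c0 :: c1 :: cs)) g)
| CompVI c alpha beta c0 c1 :
    leading (part0 f) alpha [:: c] -> leading (part0 g) beta [:: c] ->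
    part1 f != 0 -> (c1 < c0)%O ->
    composition f g (c0 :: sort <=%O [:: c1; c])
      (lie (wprod [:: c0; c1]) (alpha^-1 *: f - beta^-1 *: g))
| CompVII c e alpha beta c0 :
    part1 f != 0 -> part1 g != 0 ->
    leading (part0 f) alpha [:: c] -> leading (part0 g) beta [:: e] ->
    (e < c)%O -> (c < c0)%O ->
    composition f g [:: c0; e; c]
      (alpha^-1 *: lie (wprod [:: c0; e]) f
       - beta^-1 *: lie (wprod [:: c0; c]) g).

Definition gs_basis S : Prop :=
  (forall f, S f -> monic f) /\
  forall f g w h, S f -> S g -> composition f g w h -> trivial_mod S w h.

(* r is a remainder of h modulo the normal S-words with leading word below w. *)
Definition remainder S w h r : Prop :=
  trivial_mod S w (h - r) /\
  forall u : word Z, coef r u != 0 ->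
    ~ exists2 v, normal_below S w v & leading_word v u.

(* One round of Shirshov's algorithm: S' is obtained from S by adding nontrivial
   compositions of elements of S, each taken as it stands or replaced by a
   remainder, and then made monic. *)
Definition shirshov_step S S' : Prop :=
  S `<=` S' /\
  forall h, S' h -> S h \/
    exists f g w p r (c : k),
      [/\ S f /\ S g, composition f g w p, ~ trivial_mod S w p,
          r = p \/ remainder S w p r &
          [/\ c != 0, h = c *: r & monic h]].

Definition gs_complement S S' : Prop :=
  [/\ gs_basis S', ideal_gen S' = ideal_gen S &
      exists2 F : nat -> set L,
        F 0%N = S /\ (forall n, shirshov_step (F n) (F n.+1)) &
        S' = \bigcup_n F n].

End GroebnerShirshov.

Inductive letter (H I J : Type) : Type :=
| Lx of H
| La of I
| Lb of J.
Arguments Lx {H I J}.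
Arguments La {H I J}.
Arguments Lb {H I J}.

Section LetterOrder.
Variables (dH dI dJ : Order.disp_t).
Variables (H : orderType dH) (I : orderType dI) (J : orderType dJ).

Local Notation letter := (letter H I J).

Definition letter_encode (z : letter) : H + (I + J) :=
  match z with Lx h => inl h | La i => inr (inl i) | Lb j => inr (inr j) end.
Definition letter_decode (z : H + (I + J)) : letter :=
  match z with inl h => Lx h | inr (inl i) => La i | inr (inr j) => Lb j end.
Lemma letter_encodeK : cancel letter_encode letter_decode.
Proof. by case. Qed.

HB.instance Definition _ := Choice.copy letter (can_type letter_encodeK).

(* x_h > a_i > b_j *)
Definition letter_le (y z : letter) : bool :=
  match y, z with
  | Lx h, Lx h' => (h <= h')%O
  | La i, La i' => (i <= i')%O
  | Lb j, Lb j' => (j <= j')%O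
  | Lb _, La _ | Lb _, Lx _ | La _, Lx _ => true
  | _, _ => false
  end.

Definition letter_lt (y z : letter) : bool := (z != y) && letter_le y z.

Local Fact letter_lt_def y z : letter_lt y z = (z != y) && letter_le y z.
Proof. by []. Qed.
Local Fact letter_le_refl : reflexive letter_le.
Proof. by case=> x /=. Qed.
Local Fact letter_le_anti : antisymmetric letter_le.
Proof. by case=> x [] y //= /le_anti ->. Qed.
Local Fact letter_le_trans : transitive letter_le.
Proof. by case=> x [] y [] z //=; apply: le_trans. Qed.
Local Fact letter_le_total : total letter_le.
Proof. by case=> x [] y //=; apply: le_total. Qed.

Fact letter_display : Order.disp_t. Proof. exact: Order.Disp tt tt. Qed.

HB.instance Definition _ := Order.isPOrder.Build letter_display letter
  letter_lt_def letter_le_refl letter_le_anti letter_le_trans.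
HB.instance Definition _ :=
  Order.POrder_isTotal.Build letter_display letter letter_le_total.

Definition is_x (z : letter) : bool := if z is Lx _ then true else false.

End LetterOrder.

Section Multiplication.
Variables (k : fieldType) (dH dI dJ : Order.disp_t).
Variables (H : orderType dH) (I : orderType dI) (J : orderType dJ).

Local Notation L := (free_metab k (letter H I J)).
Local Notation x_ := (@gen k (letter H I J)).

Inductive mult_table (gamma : I -> J -> I -> k) (delta : J -> J -> I -> k) :
  set L :=
| Mult1 i j : mult_table gamma delta
    (lie (x_ (La i)) (x_ (Lb j)) - lincomb (fun l => x_ (La l)) (gamma i j))
| Mult2 i j : (j < i)%O -> mult_table gamma delta
    (lie (x_ (Lb i)) (x_ (Lb j)) - lincomb (fun l => x_ (La l)) (delta i j))
| Mult3 i j : (j < i)%O -> mult_table gamma delta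
    (lie (x_ (La i)) (x_ (La j))).

Definition x_homogeneous (f : L) : Prop :=
  exists n : nat, forall u : word (letter H I J),
    coef f u != 0 -> count (@is_x _ _ _ H I J) u = n.

End Multiplication.

(* Main.v *)
(* Id(M) is spanned by a triangular family of X-homogeneous polynomials.  Every
   a_k is congruent to an element of the derived algebra, so Id(M) contains
   [z,c] a_k for all letters z, c; together with the relations
   m(y,y') = [y,y'] - (product of y and y' in A), multiplied by letters, these
   products yield one polynomial for each of the following leading words:
   y y' ..., and x y ... with some a_i as a strict subword.  That this family
   spans an ideal follows from the Jacobi identities in L and in A.  Hence these
   are the only leading words of nonzero elements of Id(M).  Now run Shirshov's
   algorithm, replacing each nontrivial composition by a complete remainder:
   this remainder is X-homogeneous, and its leading word is not of the form
   y y' ..., because such words are leading words of normal M-words.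
   Coefficients are computed in a Magnus-type embedding of the free metabelian
   algebra, in which the coefficient of c_0 c_1 ... c_n is that of the monomial
   c_1 ... c_n in the component c_0. *)
Require Import Defs.
From mathcomp Require Import all_boot all_order all_algebra.
From mathcomp Require Import finmap multiset.
From mathcomp Require Import boolp classical_sets cardinality fsbigop
  wochoice.
From mathcomp.multinomials Require Import monalg.
From mathcomp Require Import ring.

Set Implicit Arguments.
Unset Strict Implicit.
Unset Printing Implicit Defensive.

Import Order.TTheory GRing.Theory.

Local Open Scope classical_set_scope.
Local Open Scope ring_scope.

(** * Subspaces, spans and finite linear combinations *)

Section LinearCombinations.
Variables (k : fieldType) (V : lmodType k).
Implicit Types (P Q : set V).

(** The triangular family enters through one inclusion: Id(M) lies in its span. This bounds the
    leading words of the whole ideal, so no composition is ever computed; only its bound [w] and its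
    X-degree are tracked. The obstacle is that the span must absorb multiplication by letters. Two
    claims are intertwined: one on products of m(y,y') by letters, one on [z,c] times letters among
    which some a_i occurs. Letters behind m(y,y') do not commute freely, because its linear part is
    a combination of letters a_k, and exchanging c and c' behind a_k costs [c,c'] a_k: an instance
    of the second claim with fewer letters. Conversely, replacing [y,y'] by the product in A reduces
    the second claim to the first. Both are settled by one induction on the number of letters.
    Shirshov's algorithm need not stop: the complement is the union of countably many rounds, and
    any two of its elements already lie in a common round. The (0)-part vanishes for reasons of
    X-degree: the leading word starts with some x, so a linear term would be a letter of X, and no
    element of Id(M) contains one. *)

Definition subspace Q : Prop :=
  [/\ Q 0, forall u v, Q u -> Q v -> Q (u + v)
    & forall (c : k) u, Q u -> Q (c *: u)].

Lemma subspaceB Q u v : subspace Q -> Q u -> Q v -> Q (u - v).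
Proof.
by case=> _ QD QZ Qu Qv; rewrite -scaleN1r; apply: QD => //; apply: QZ.
Qed.

Lemma subspace_sum Q (T : eqType) (s : seq T) (F : T -> V) :
  subspace Q -> (forall t, t \in s -> Q (F t)) -> Q (\sum_(t <- s) F t).
Proof.
case=> Q0 QD _ QF; elim: s QF => [|t s IH] QF; first by rewrite big_nil.
rewrite big_cons; apply: QD; first by apply: QF; rewrite mem_head.
by apply: IH => t' t's; apply: QF; rewrite in_cons t's orbT.
Qed.

Lemma lin_span_subspace P : subspace (lin_span P).
Proof.
split.
- by exists [::] => //; rewrite big_nil.
- move=> _ _ [s sP ->] [t tP ->]; exists (s ++ t); last by rewrite big_cat.
  by move=> c; rewrite mem_cat => /orP[/sP|/tP].
- move=> c _ [s sP ->]; exists [seq (c * d.1, d.2) | d <- s].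
    by move=> _ /mapP[d /sP Pd ->].
  by rewrite big_map scaler_sumr; apply: eq_bigr => d _; rewrite scalerA.
Qed.

Lemma lin_span_gen P v : P v -> lin_span P v.
Proof.
move=> Pv; exists [:: (1, v)]; last by rewrite big_seq1 scale1r.
by move=> c; rewrite inE => /eqP ->.
Qed.

Lemma lin_span_ind P Q : subspace Q -> P `<=` Q -> lin_span P `<=` Q.
Proof.
move=> Qs PQ _ [s sP ->]; apply: subspace_sum => // c /sP Pc.
by case: Qs => _ _; apply; apply: PQ.
Qed.

Lemma lin_spanS P Q : P `<=` Q -> lin_span P `<=` lin_span Q.
Proof.
by move=> PQ; apply: lin_span_ind (lin_span_subspace Q) _ => v /PQ; apply: lin_span_gen.
Qed.

Lemma lincombE (T : choiceType) (e : T -> V) (p : T -> k) (s : seq T) :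
  uniq s -> (forall t, p t != 0 -> t \in s) ->
  lincomb e p = \sum_(t <- s) p t *: e t.
Proof.
move=> us ps; rewrite /lincomb (@fsbigE _ _ _ _ _ s) //.
  by apply: eq_bigl => t; apply: mem_set.
move=> t _ /negP ts; have [->|/ps //] := eqVneq (p t) 0.
by rewrite scale0r.
Qed.

Lemma fin_supp_seq (T : choiceType) (p : T -> k) : fin_supp p ->
  exists2 s : seq T, uniq s & forall t, (t \in s) = (p t != 0).
Proof.
move=> fp; exists (fset_set [set t | p t != 0]); first exact: fset_uniq.
by move=> t; rewrite in_fset_set //; apply/idP/idP => [/set_mem|pt]; last exact: mem_set.
Qed.

Lemma seq_fin_supp (T : choiceType) (p : T -> k) (s : seq T) :
  (forall t, p t != 0 -> t \in s) -> fin_supp p.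
Proof. by move=> ps; apply: (@sub_finite_set _ _ [set` s]); [exact: ps | exact: finite_seq]. Qed.

Lemma lincomb_add (T : choiceType) (e : T -> V) (p q : T -> k) :
  fin_supp p -> fin_supp q -> fin_supp (fun t => p t + q t) /\
  lincomb e (fun t => p t + q t) = lincomb e p + lincomb e q.
Proof.
move=> /fin_supp_seq[s us sE] /fin_supp_seq[r ur rE].
pose sr := undup (s ++ r); have usr : uniq sr by exact: undup_uniq.
have pq t : p t + q t != 0 -> t \in sr.
  rewrite mem_undup mem_cat sE rE; apply: contraR.
  by rewrite negb_or !negbK => /andP[/eqP -> /eqP ->]; rewrite addr0.
split; first exact: seq_fin_supp pq.
rewrite !(@lincombE _ e _ sr) // => [|t|t]; last 2 first.
- by rewrite mem_undup mem_cat rE => ->; rewrite orbT.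
- by rewrite mem_undup mem_cat sE => ->.
by rewrite -big_split; apply: eq_bigr => t _; rewrite scalerDl.
Qed.

Lemma lincomb_scale (T : choiceType) (e : T -> V) (c : k) (p : T -> k) :
  fin_supp p -> fin_supp (fun t => c * p t) /\
  lincomb e (fun t => c * p t) = c *: lincomb e p.
Proof.
move=> /fin_supp_seq[s us sE].
have cp t : c * p t != 0 -> t \in s by rewrite mulf_eq0 sE negb_or => /andP[].
split; first exact: seq_fin_supp cp.
rewrite !(@lincombE _ e _ s) // => [|t]; last by rewrite sE.
by rewrite scaler_sumr; apply: eq_bigr => t _; rewrite scalerA.
Qed.

Lemma lincomb0 (T : choiceType) (e : T -> V) :
  fin_supp (fun _ : T => 0 : k) /\ lincomb e (fun=> 0) = 0.
Proof.
split; first by apply: (@seq_fin_supp _ _ [::]) => t; rewrite eqxx.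
by rewrite (@lincombE _ _ _ [::]) ?big_nil // => t; rewrite eqxx.
Qed.

Lemma lincomb_delta (T : choiceType) (e : T -> V) (t : T) :
  fin_supp (fun t' => (t == t')%:R : k) /\ lincomb e (fun t' => (t == t')%:R) = e t.
Proof.
have st t' : (t == t')%:R != 0 :> k -> t' \in [:: t].
  by rewrite inE [t' == t]eq_sym; case: (t == t'); rewrite ?eqxx.
split; first exact: seq_fin_supp st.
by rewrite (lincombE _ _ st) // big_seq1 eqxx scale1r.
Qed.

Lemma lin_span_range (T : choiceType) (e : T -> V) v : lin_span (range e) v ->
  exists2 p : T -> k, fin_supp p & v = lincomb e p.
Proof.
move: v; apply: lin_span_ind => [|_ [t _ <-]]; last first.
  by have [ft <-] := lincomb_delta e t; exists (fun t' => (t == t')%:R).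
split.
- by have [f0 <-] := lincomb0 e; exists (fun=> 0).
- move=> _ _ [p fp ->] [q fq ->]; have [fpq <-] := lincomb_add e fp fq.
  by exists (fun t => p t + q t).
- move=> c _ [p fp ->]; have [fcp <-] := lincomb_scale e c fp.
  by exists (fun t => c * p t).
Qed.

Lemma lincomb_subspace (T : choiceType) (e : T -> V) (p : T -> k) Q :
  subspace Q -> fin_supp p -> (forall t, p t != 0 -> Q (e t)) -> Q (lincomb e p).
Proof.
move=> Qs /fin_supp_seq[s us sE] Qe; rewrite (@lincombE _ _ _ s) // => [|t].
  by apply: subspace_sum => // t; rewrite sE => /Qe Qt; case: Qs => _ _; apply.
by rewrite sE.
Qed.

Lemma coordsP (T : choiceType) (e : T -> V) v : lin_span (range e) v ->
  fin_supp (coords e v) /\ v = lincomb e (coords e v).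
Proof.
move=> /lin_span_range[p fp vp]; rewrite /coords.
by case: xgetP => [q _ //|/(_ p)[]].
Qed.

End LinearCombinations.

Section LieIdentities.
Variables (k : fieldType) (L : lieAlgType k).
Implicit Types f g h : L.

Lemma lie0l f : lie 0 f = 0.
Proof. by rewrite -[X in lie X f](scale0r 0) lieZl scale0r. Qed.
Lemma lie0r f : lie f 0 = 0.
Proof. by rewrite -[X in lie f X](scale0r 0) lieZr scale0r. Qed.
Lemma lieNl f g : lie (- f) g = - lie f g.
Proof. by rewrite -scaleN1r lieZl scaleN1r. Qed.
Lemma lieNr f g : lie f (- g) = - lie f g.
Proof. by rewrite -scaleN1r lieZr scaleN1r. Qed.
Lemma lieBl f g h : lie (f - g) h = lie f h - lie g h.
Proof. by rewrite lieDl lieNl. Qed.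
Lemma lieBr f g h : lie f (g - h) = lie f g - lie f h.
Proof. by rewrite lieDr lieNr. Qed.
Lemma lieC f g : lie f g = - lie g f.
Proof.
apply/eqP; rewrite -addr_eq0; apply/eqP.
by have := lie_alt (f + g); rewrite lieDl !lieDr !lie_alt addr0 add0r.
Qed.
Lemma lieAC f g h : lie (lie f g) h = lie (lie f h) g - lie (lie g h) f.
Proof.
apply/eqP; rewrite -subr_eq0 -[X in _ == X](lie_jacobi f g h) opprB.
by rewrite [lie h f]lieC lieNl addrA.
Qed.

End LieIdentities.

(** * The Magnus-type embedding, on terms, on Lie(Z), and on its metabelian quotient *)

Section Evaluation.
Variables (k : fieldType) (Z : choiceType) (T : comAlgType k) (var : Z -> T).

(** With [ev2] this interprets a term in the metabelian Lie algebra of pairs (p, v), p in [T] and v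
    : [Z -> T], where the bracket of (p, v) and (q, w) is (0, q v - p w). Hence the value 0 on
    products. *)
Fixpoint ev1 (t : lie_term k Z) : T :=
  match t with
  | LVar z => var z
  | LZero => 0
  | LAdd s t => ev1 s + ev1 t
  | LScale c t => c *: ev1 t
  | LMul _ _ => 0
  end.

Fixpoint ev2 (t : lie_term k Z) (z : Z) : T :=
  match t with
  | LVar z' => (z == z')%:R
  | LZero => 0
  | LAdd s t => ev2 s z + ev2 t z
  | LScale c t => c *: ev2 t z
  | LMul s t => ev1 t * ev2 s z - ev1 s * ev2 t z
  end.

Lemma ev_cong s t : lie_cong s t -> ev1 s = ev1 t /\ ev2 s =1 ev2 t.
Proof.
elim=> {s t} //=.
- by move=> s t _ [-> e]; split=> // z; rewrite e.
- by move=> r s t _ [-> e] _ [-> f]; split=> // z; rewrite e f.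
- by move=> s s' t t' _ [-> e] _ [-> f]; split=> // z; rewrite e f.
- by move=> c t t' _ [-> e]; split=> // z; rewrite e.
- by move=> s s' t t' _ [-> e] _ [-> f]; split=> // z; rewrite e f.
- by move=> r s t; split=> [|z]; rewrite addrA.
- by move=> s t; split=> [|z]; rewrite addrC.
- by move=> t; split=> [|z]; rewrite add0r.
- by move=> t; split=> [|z]; rewrite scaleN1r addNr.
- by move=> c d t; split=> [|z]; rewrite scalerA.
- by move=> t; split=> [|z]; rewrite scale1r.
- by move=> c s t; split=> [|z]; rewrite scalerDr.
- by move=> c d t; split=> [|z]; rewrite scalerDl.
- by move=> r s t; split=> [|z]; [rewrite addr0 | ring].
- by move=> r s t; split=> [|z]; [rewrite addr0 | ring].
- by move=> c s t; split=> [|z]; rewrite ?scaler0 // -!(scalerAl, scalerAr) scalerBr.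
- by move=> c s t; split=> [|z]; rewrite ?scaler0 // -!(scalerAl, scalerAr) scalerBr.
- by move=> t; split=> // z; rewrite subrr.
- by move=> r s t; split=> [|z]; [rewrite !addr0 | ring].
Qed.


Definition fev1 (u : free_lie k Z) : T := ev1 (Defs.frp u).
Definition fev2 (u : free_lie k Z) (z : Z) : T := ev2 (Defs.frp u) z.

Lemma fev1E t : fev1 (Defs.cl t) = ev1 t.
Proof. by have [] := ev_cong (Defs.frpP t). Qed.
Lemma fev2E t z : fev2 (Defs.cl t) z = ev2 t z.
Proof. by have [_] := ev_cong (Defs.frpP t); apply. Qed.

Lemma fev1D u v : fev1 (u + v) = fev1 u + fev1 v.
Proof. exact: fev1E. Qed.
Lemma fev2D u v z : fev2 (u + v) z = fev2 u z + fev2 v z.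
Proof. exact: fev2E. Qed.
Lemma fev1Z c u : fev1 (c *: u) = c *: fev1 u.
Proof. exact: fev1E. Qed.
Lemma fev2Z c u z : fev2 (c *: u) z = c *: fev2 u z.
Proof. exact: fev2E. Qed.
Lemma fev1M u v : fev1 (lie u v) = 0.
Proof. exact: fev1E. Qed.
Lemma fev2M u v z : fev2 (lie u v) z = fev1 v * fev2 u z - fev1 u * fev2 v z.
Proof. exact: fev2E. Qed.
Lemma fev1_0 : fev1 0 = 0. Proof. exact: fev1E. Qed.
Lemma fev2_0 z : fev2 0 z = 0. Proof. exact: fev2E. Qed.

(** A commutator has first component 0, so the bracket formula gives 0 on two elements of the
    derived algebra; the common kernel of both components is an ideal. *)
Lemma fev_derived2 u : ideal_gen (derived 2) u -> fev1 u = 0 /\ fev2 u =1 fun=> 0.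
Proof.
have der1 v : derived 1 v -> fev1 v = 0.
  move: v; apply: lin_span_ind => [|_ [v [w [_ _ ->]]]]; last exact: fev1M.
  split=> [|v w v0 w0|c v v0]; rewrite /= ?fev1_0 ?fev1D ?fev1Z ?v0 ?w0 //.
    by rewrite addr0.
  by rewrite scaler0.
pose K := [set v | fev1 v = 0 /\ fev2 v =1 fun=> 0].
have KI : lie_ideal K.
  split=> [|v w [v1 v2] [w1 w2]|c v [v1 v2]|v w [v1 v2]].
  - by split=> [|z]; rewrite ?fev1_0 ?fev2_0.
  - by split=> [|z]; rewrite ?fev1D ?fev2D ?v1 ?w1 ?v2 ?w2 addr0.
  - by split=> [|z]; rewrite ?fev1Z ?fev2Z ?v1 ?v2 scaler0.
  - by split; split=> [|z]; rewrite ?fev1M ?fev2M // v1 v2 mulr0 mul0r subrr.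
move=> uI; apply: (uI K KI); have [K0 KD KZ _] := KI.
apply: lin_span_ind => [|_ [v [w [/der1 v0 /der1 w0 ->]]]]; first by split.
by split=> [|z]; rewrite ?fev1M ?fev2M // v0 w0 !mul0r subrr.
Qed.

(* The Magnus-type embedding of [free_metab k Z] into the semidirect product of
   [T] acting by multiplication on [Z -> T], which sends [z] to the pair of
   [var z] and the basis vector at [z]; [ev] is its second component. *)
Definition ev0 (u : free_metab k Z) : T := fev1 (Defs.rp u).
Definition ev (u : free_metab k Z) (z : Z) : T := fev2 (Defs.rp u) z.

Lemma ev_proj u : ev0 (lie_proj _ u) = fev1 u /\ ev (lie_proj _ u) =1 fev2 u.
Proof.
have [e1 e2] := fev_derived2 (Defs.rpP u).
have eN w : fev1 (- w) = - fev1 w /\ forall z, fev2 (- w) z = - fev2 w z.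
  by split=> [|z]; rewrite -!scaleN1r ?fev1Z ?fev2Z.
split=> [|z]; apply/eqP; rewrite -subr_eq0.
  by rewrite -(proj1 (eN u)) -fev1D e1.
by rewrite -(proj2 (eN u)) -fev2D e2.
Qed.

Lemma evD u v z : ev (u + v) z = ev u z + ev v z.
Proof. by rewrite (proj2 (ev_proj _)) fev2D. Qed.
Lemma evZ c u z : ev (c *: u) z = c *: ev u z.
Proof. by rewrite (proj2 (ev_proj _)) fev2Z. Qed.
Lemma ev0M u v : ev0 (lie u v) = 0.
Proof. by rewrite (proj1 (ev_proj _)) fev1M. Qed.
Lemma evM u v z : ev (lie u v) z = ev0 v * ev u z - ev0 u * ev v z.
Proof. by rewrite (proj2 (ev_proj _)) fev2M. Qed.
Lemma ev0_gen z : ev0 (gen k z) = var z.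
Proof. by rewrite (proj1 (ev_proj _)) fev1E. Qed.
Lemma ev_gen z z' : ev (gen k z) z' = (z' == z)%:R.
Proof. by rewrite (proj2 (ev_proj _)) fev2E. Qed.

End Evaluation.

(** * Identities of left-normed products in the free metabelian algebra *)

Section FreeMetabelian.
Variables (k : fieldType) (d : Order.disp_t) (Z : orderType d).
Local Notation L := (free_metab k Z).
Local Notation x_ := (@gen k Z).
Implicit Types (f g h : L) (u v w cs : seq Z).

Lemma lie_metab f g f' g' : lie (lie f g) (lie f' g') = 0.
Proof.
rewrite -(Defs.rpK f) -(Defs.rpK g) -(Defs.rpK f') -(Defs.rpK g') -!lie_projM.
rewrite -(lie_proj0 (derived 2)); apply/lie_projP; rewrite subr0.
have [_ _ _ _] := ideal_gen_ideal (derived (L := free_lie k Z) 2).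
move=> J _; apply; apply: lin_span_gen; eexists; eexists; split; last by [].
  by apply: lin_span_gen; eexists; eexists; split; last by [].
by apply: lin_span_gen; eexists; eexists; split; last by [].
Qed.

Lemma free_metab_ind (Q : set L) : subspace Q ->
  (forall f g, Q f -> Q g -> Q (lie f g)) -> (forall z, Q (x_ z)) -> forall f, Q f.
Proof.
case=> Q0 QD QZ QM Qx f; rewrite -(Defs.rpK f) -(Defs.frpK (Defs.rp f)).
elim: (Defs.frp (Defs.rp f)) => {f} [z||s IHs t IHt|c t IH|s IHs t IHt] //.
- exact: Qx.
- by have := QD _ _ IHs IHt; rewrite -lie_projD [_ + _]Defs.faddE.
- by have := QZ c _ IH; rewrite -lie_projZ [_ *: _]Defs.fscaleE.
- by have := QM _ _ IHs IHt; rewrite -lie_projM [lie _ _]Defs.flieE.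
Qed.

Definition der1 f : Prop := exists g h, f = lie g h.

Lemma lnprod_rcons f cs c : lnprod f (rcons cs c) = lie (lnprod f cs) (x_ c).
Proof. by rewrite /lnprod foldl_rcons. Qed.

Lemma lnprod_cat f cs ds : lnprod f (cs ++ ds) = lnprod (lnprod f cs) ds.
Proof. by rewrite /lnprod foldl_cat. Qed.

Lemma lnprod_der1 f g cs : der1 (lnprod (lie f g) cs).
Proof.
case/lastP: cs => [|cs c]; first by exists f, g.
by rewrite lnprod_rcons; exists (lnprod (lie f g) cs), (x_ c).
Qed.

(** By Jacobi the two sides differ by a bracket of two commutators. This is why all letters after
    the second one may be permuted. *)
Lemma lie_swap f g h h' : lie (lie (lie f g) h) h' = lie (lie (lie f g) h') h.
Proof. by rewrite lieAC lie_metab subr0. Qed.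

Lemma lnprod_cons f c cs : lnprod f (c :: cs) = lnprod (lie f (x_ c)) cs.
Proof. by []. Qed.

Lemma lnprodD f g cs : lnprod (f + g) cs = lnprod f cs + lnprod g cs.
Proof. by elim: cs f g => // c cs IH f g; rewrite !lnprod_cons -IH lieDl. Qed.

Lemma lnprodZ (a : k) f cs : lnprod (a *: f) cs = a *: lnprod f cs.
Proof. by elim: cs f => // c cs IH f; rewrite !lnprod_cons -IH lieZl. Qed.

Lemma lnprod0 cs : lnprod (0 : L) cs = 0.
Proof. by elim: cs => // c cs IH; rewrite lnprod_cons lie0l. Qed.

Lemma lnprodN f cs : lnprod (- f) cs = - lnprod f cs.
Proof. by rewrite -scaleN1r lnprodZ scaleN1r. Qed.

Lemma lnprodB f g cs : lnprod (f - g) cs = lnprod f cs - lnprod g cs.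
Proof. by rewrite lnprodD lnprodN. Qed.

Lemma lnprod_lie f g cs c : lnprod (lie (lie f g) (x_ c)) cs =
  lie (lnprod (lie f g) cs) (x_ c).
Proof.
by elim: cs f g => // c' cs IH f g; rewrite lnprod_cons lie_swap IH.
Qed.

Lemma lnprod_perm f g cs ds : perm_eq cs ds ->
  lnprod (lie f g) cs = lnprod (lie f g) ds.
Proof.
elim: cs ds f g => [|c cs IH] ds f g; first by rewrite perm_sym => /perm_nilP ->.
move=> cds; have : c \in ds by rewrite -(perm_mem cds) mem_head.
move=> /[dup] cd; case/splitPr: cd cds => ds1 ds2 + _.
rewrite -[_ :: ds2]cat1s perm_sym perm_catCA perm_cons perm_sym => /IH E.
by rewrite lnprod_cons E !lnprod_cat lnprod_lie.
Qed.

End FreeMetabelian.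


Lemma malgUM (K : monomType) (R : ringType) (m n : K) :
  << m >> * << n >> = << mmul m n >> :> {malg R[K]}.
Proof. by rewrite malgM_def fgmulUU mulr1. Qed.

(** * Commutative monomials and the coefficient functionals of regular words *)

Section Monomials.
Variables (k : fieldType) (Z : choiceType).
Implicit Types cs ds : seq Z.

Definition mon cs : {cmonom Z} := \big[mmul/mone]_(c <- cs) ucm c.

Lemma prod_var cs :
  \prod_(c <- cs) << ucm c >> = << mon cs >> :> {malg k[{cmonom Z}]}.
Proof.
rewrite /mon; elim: cs => [|c cs IH].
  rewrite (big_nil _ mmul) (big_nil _ *%R).
  exact: esym (mpolyC1E _ _).
rewrite (big_cons _ mmul) (big_cons _ *%R).
rewrite IH.
exact: malgUM.
Qed.

Lemma mon_perm cs ds : (mon cs == mon ds) = perm_eq cs ds.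
Proof.
have monE es z : mon es z = count_mem z es.
  rewrite /mon; elim: es => [|e es IH]; first by rewrite big_nil cm1.
  by rewrite big_cons cmM cmU IH.
apply/cmP/allP => [e z _|e z]; first by rewrite /= -!monE e.
rewrite !monE; have [zcd|zcd] := boolP (z \in cs ++ ds); first exact/eqP/e.
by move: zcd; rewrite mem_cat => /norP[]; do 2 move=> /count_memPn ->.
Qed.

End Monomials.

Lemma sorted_uniq_perm (d : Order.disp_t) (Z : orderType d) (cs ds : seq Z) :
  sorted <=%O cs -> sorted <=%O ds -> perm_eq cs ds = (cs == ds).
Proof.
move=> scs sds; apply/idP/eqP => [|-> //].
exact: (sorted_eq le_trans le_anti).
Qed.

Section EvaluationWords.
Variables (k : fieldType) (d : Order.disp_t) (Z : orderType d).
Variables (T : comAlgType k) (var : Z -> T).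

Lemma ev_lnprod (u v : free_metab k Z) cs z :
  ev var (lnprod (lie u v) cs) z = ev var (lie u v) z * \prod_(c <- cs) var c.
Proof.
elim/last_ind: cs => [|cs c IH]; first by rewrite big_nil mulr1.
have [f [g E]] := lnprod_der1 u v cs.
rewrite lnprod_rcons evM ev0_gen {2}E ev0M mul0r subr0 IH -cats1 big_cat big_seq1.
by rewrite mulrCA [var c * _]mulrC.
Qed.

Lemma ev_wprod c0 c1 cs z : ev var (wprod k (c0 :: c1 :: cs)) z =
  (if z == c0 then \prod_(c <- c1 :: cs) var c else 0)
  - (if z == c1 then \prod_(c <- c0 :: cs) var c else 0).
Proof.
rewrite [wprod _ _](lnprod_cons (gen k c0) c1) ev_lnprod evM !ev0_gen !ev_gen.
by rewrite !big_cons mulrBl; do 2 case: eqP => _; rewrite ?mulr1 ?mulr0 ?mul0r.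
Qed.



(* [mc ds] stands for the coefficient of the monomial [ds]. *)
Variable mc : seq Z -> T -> k.
Hypothesis mcD : forall ds p q, mc ds (p + q) = mc ds p + mc ds q.
Hypothesis mcZ : forall ds c p, mc ds (c *: p) = c * mc ds p.
Hypothesis mc_var : forall cs ds, mc ds (\prod_(c <- cs) var c) = (perm_eq cs ds)%:R.

Definition word_coef (v : seq Z) (f : free_metab k Z) : k :=
  if v is c0 :: cs then mc cs (ev var f c0) else 0.

Lemma mcB ds p q : mc ds (p - q) = mc ds p - mc ds q.
Proof. by rewrite -scaleN1r mcD mcZ mulN1r. Qed.

Lemma mc0 ds : mc ds 0 = 0.
Proof. by rewrite -(subrr 0) mcB subrr. Qed.

(* Besides the word [d0 ds], only words starting with [e d0] could contribute to
   the coefficient of the monomial [ds] in component [d0]; they do not, because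
   there [d0] would be minimal among the other letters. *)
Lemma word_coef_wprod (u v : word Z) :
  word_coef v (wprod k u) = (u == v)%:R.
Proof.
rewrite /word_coef -(inj_eq val_inj) /=.
case: v => v rv; case: u => u ru /=; case: v rv => [//|d0 ds] rv.
case: u ru => [//|c0 [|c1 cs]] ru.
  change (wprod k [:: c0]) with (gen k c0); rewrite ev_gen.
  rewrite eqseq_cons [c0 == d0]eq_sym; case: (d0 =P c0) => [_|_]; last exact: mc0.
  have := mc_var [::] ds; rewrite big_nil => ->.
  by rewrite perm_sym (sameP perm_nilP eqP) [[::] == _]eq_sym.
rewrite ev_wprod mcB.
have mc_if (b : bool) es : mc ds (if b then \prod_(c <- es) var c else 0) =
    (b && perm_eq es ds)%:R by case: b; rewrite ?mc_var ?mc0.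
rewrite !mc_if {mc_if}.
case/andP: ru => c10 scs.
have sds : sorted <=%O ds by case: ds rv => // d1 ds /andP[].
rewrite sorted_uniq_perm //= [in RHS]eqseq_cons [c0 == d0]eq_sym.
case: (d0 =P c1) => [E|_]; last by rewrite subr0.
case: (boolP (perm_eq _ _)) => [p|_]; last by rewrite subr0.
have : (d0 < d0)%O; last by rewrite ltxx.
have: c0 \in ds by rewrite -(perm_mem p) mem_head.
case: ds rv sds p => // d1 ds /andP[d10 _] sds p c0d.
have: (d1 \in c0 :: cs) by rewrite (perm_mem p) mem_head.
rewrite inE => /orP[/eqP e|d1cs]; first by move: d10; rewrite e E ltNge ltW.
have := order_path_min le_trans scs => /allP /(_ _ d1cs).
by rewrite -E leNgt d10.
Qed.

End EvaluationWords.

(** [T] becomes the polynomial algebra in the letters and [mc] its coefficient functionals. Being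
    dual to the regular words, these functionals prove their linear independence. *)
Lemma word_coef_exists (k : fieldType) (d : Order.disp_t) (Z : orderType d) :
  exists wc : seq Z -> free_metab k Z -> k,
    [/\ forall v f g, wc v (f + g) = wc v f + wc v g,
        forall v c f, wc v (c *: f) = c * wc v f
      & forall u v : word Z, wc v (wprod k u) = (u == v)%:R].
Proof.
pose T := {malg k[{cmonom Z}]}.
pose mc ds (p : T) := p@_(mon ds).
have mcD ds p q : mc ds (p + q) = mc ds p + mc ds q by exact: mcoeffD.
have mcZ ds c p : mc ds (c *: p) = c * mc ds p by exact: mcoeffZ.
have mcv cs ds : mc ds (\prod_(c <- cs) << ucm c >>) = (perm_eq cs ds)%:R.
  by rewrite /mc prod_var mcoeffU1 mon_perm.
exists (word_coef (fun z => << ucm z >> : T) mc); split.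
- by move=> [|c0 cs] f g; rewrite /word_coef ?addr0 // evD mcD.
- by move=> [|c0 cs] c f; rewrite /word_coef ?mulr0 // evZ mcZ.
- exact: word_coef_wprod.
Qed.


(** * Insertion of letters and the degree-lexicographic order *)

Section WordOrder.
Variables (d : Order.disp_t) (Z : orderType d).
Implicit Types (u v w cs ds : seq Z) (a b c : Z).

(** Defined by recursion rather than by sorting, so that monotonicity for the word order follows by
    induction on the words. *)
Fixpoint ins c cs : seq Z :=
  if cs is a :: cs' then if (c <= a)%O then c :: cs else a :: ins c cs'
  else [:: c].

Lemma perm_ins c cs : perm_eq (ins c cs) (c :: cs).
Proof.
elim: cs => //= a cs IH; case: ifP => // _.
by rewrite -(cat1s a) -[c :: a :: cs]/([:: c] ++ [:: a] ++ cs) perm_sym perm_catCA perm_cons perm_sym.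
Qed.

Lemma sorted_ins c cs : sorted <=%O cs -> sorted <=%O (ins c cs).
Proof.
elim: cs => //= a cs IH acs; case: ifP => [ca|/negbT]; first by rewrite /= ca.
rewrite -ltNge => /ltW ac; have := IH (path_sorted acs).
case: cs acs {IH} => [|b cs] /=; first by rewrite ac.
by case/andP=> ab _; case: ifP => _ /=; rewrite ?ac ?ab.
Qed.

Lemma size_ins c cs : size (ins c cs) = (size cs).+1.
Proof. exact: perm_size (perm_ins c cs). Qed.

Lemma sorted_perm cs ds : sorted <=%O cs -> sorted <=%O ds -> perm_eq cs ds -> cs = ds.
Proof. by move=> scs sds; rewrite sorted_uniq_perm // => /eqP. Qed.

Lemma sort_ins c cs : sorted <=%O cs -> sort <=%O (c :: cs) = ins c cs.
Proof.
move=> scs; apply: sorted_perm; [exact: sort_sorted le_total _ | exact: sorted_ins |].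
by rewrite perm_sort perm_sym perm_ins.
Qed.

Lemma ins_head c cs : (if cs is a :: _ then c <= a else true)%O ->
  ins c cs = c :: cs.
Proof. by case: cs => //= a cs ->. Qed.

Lemma word_lt_irr u : word_lt u u = false.
Proof. by rewrite /word_lt ltnn eqxx ltxx. Qed.

Lemma word_lt_trans : transitive (@word_lt d Z).
Proof.
move=> v u w; rewrite /word_lt => /orP[suv|/andP[/eqP -> uv]] /orP[svw|/andP[/eqP <- vw]].
- by rewrite (ltn_trans suv svw).
- by rewrite suv.
- by rewrite svw.
- by rewrite eqxx (lt_trans uv vw) orbT.
Qed.

Lemma word_lt_total u v : [|| word_lt u v, u == v | word_lt v u].
Proof.
rewrite /word_lt; case: (ltngtP (size u) (size v)) => //= [_|E]; first by rewrite orbT.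
by case: (ltgtP (u : seqlexi Z) (v : seqlexi Z)) => // ->; rewrite eqxx.
Qed.

Lemma word_lt_size u v : (size u < size v)%N -> word_lt u v.
Proof. by rewrite /word_lt => ->. Qed.

Lemma word_lt_leq u v : word_lt u v -> (size u <= size v)%N.
Proof. by rewrite /word_lt => /orP[/ltnW|/andP[/eqP ->]]. Qed.

Lemma word_lt_cons a b u v : word_lt (a :: u) (b :: v) =
  (size u < size v)%N || (size u == size v) &&
  ((a < b)%O || (a == b) && word_lt u v).
Proof.
rewrite /word_lt /= ltnS eqSS ltxi_cons.
case: (ltngtP (size u) (size v)) => //= _.
by case: (ltgtP a b).
Qed.

(** Compatibility of the order with multiplication by a letter. At the first difference a < b,
    either [c] precedes both, or a precedes [c] and thus beats whatever stands at that place in the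
    other word. *)
Lemma word_lt_ins c u v : word_lt u v -> word_lt (ins c u) (ins c v).
Proof.
elim: u v => [|a u IH] [|b v] //=.
- by move=> _; apply: word_lt_size; case: ifP => //= _; rewrite size_ins.
rewrite word_lt_cons => /orP[uv|/andP[/eqP uv /orP[ab|/andP[/eqP <- lt]]]].
- by apply: word_lt_size; do 2 case: ifP => /=; rewrite ?size_ins.
- case: (leP c a) => [ca|ac].
    by rewrite (le_trans ca (ltW ab)) !word_lt_cons /= uv !ltnn !eqxx ab ltxx.
  by case: ifP => _; rewrite word_lt_cons /= ?size_ins uv ltnn eqxx ?ac ?ab.
- by case: ifP => _; rewrite !word_lt_cons /= ?size_ins uv !ltnn !eqxx ?(IH _ lt) ?lt ?orbT /= ?orbT.
Qed.

End WordOrder.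

Section WordOrderWf.
Variables (d : Order.disp_t) (Z : orderType d).
Hypothesis wfZ : well_founded (fun a b : Z => (a < b)%O).

(** Induction on the length first; among words of one fixed length the order is a finite
    lexicographic product, handled by induction on the first letter and then on the tail. *)
Lemma word_lt_wf : well_founded (fun u v : seq Z => word_lt u v).
Proof.
suff main n (s : seq Z) : size s = n -> Acc (fun u v : seq Z => word_lt u v) s.
  by move=> s; apply: (main (size s)).
elim/ltn_ind: n s => n IHn s sn.
pose R (u v : seq Z) := (size u == size v) && word_lt u v.
suff: Acc R s.
  move=> accs; elim: accs sn => {}s _ IH sn; constructor => u us.
  have := word_lt_leq us; rewrite leq_eqVlt => /orP[/eqP e|lt].
    by apply: IH; rewrite ?e // /R e eqxx.
  by apply: IHn; first rewrite -sn; first exact: lt.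
elim: n s {IHn} sn => [|n IHn] [|a s] sn; [|by discriminate sn|by discriminate sn|].
  by constructor=> -[|b u] /andP[//]; rewrite word_lt_irr.
case: sn => sn; elim/(well_founded_ind wfZ): a s sn => a IHa s sn.
have acs := IHn s sn; elim: acs sn => {}s _ IHs sn.
constructor=> -[|b u] /andP[/eqP us]; first by discriminate us.
case: us => us; rewrite word_lt_cons us ltnn eqxx /=.
case/orP=> [ba|/andP[/eqP -> lt]]; first by apply: (IHa b ba); rewrite us.
by apply: IHs; [rewrite /R us eqxx | rewrite us].
Qed.

End WordOrderWf.

(** * Regular words span the free metabelian algebra *)

Section RegularWords.
Variables (k : fieldType) (d : Order.disp_t) (Z : orderType d).
Local Notation L := (free_metab k Z).
Local Notation x_ := (@gen k Z).
Local Notation wp := (@wprod k d Z).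
Implicit Types (f g h : L) (u w cs ds : seq Z) (v : word Z) (a b c : Z).

(** The leading word of the product of a regular word [u] of length at least 2 by the letter [c]:
    the first letter keeps its place. *)
Definition insw u c : seq Z := if u is c0 :: cs then c0 :: ins c cs else [::].

Lemma regular_cons c0 cs : regular_word (c0 :: cs) ->
  sorted <=%O cs /\ all (fun c => head c0 cs <= c)%O cs.
Proof.
case: cs => [|c1 cs] //= /andP[_ scs]; split=> //.
by rewrite lexx (order_path_min le_trans).
Qed.

Lemma regular_insw u c : regular_word u -> (1 < size u)%N ->
  regular_word (insw u c).
Proof.
case: u => [|c0 [|c1 cs]] // /andP[c10 scs] _.
have := sorted_ins c scs; rewrite /insw /=.
by case: (leP c c1) => [cc1|_] /= ->; rewrite ?andbT ?(le_lt_trans cc1).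
Qed.

Lemma size_insw u c : (0 < size u)%N -> size (insw u c) = (size u).+1.
Proof. by case: u => //= c0 cs; rewrite size_ins. Qed.

Lemma count_ins (P : pred Z) c cs : count P (ins c cs) = (P c + count P cs)%N.
Proof. by rewrite (permP (perm_ins c cs)). Qed.

Lemma count_insw (P : pred Z) u c : (0 < size u)%N ->
  count P (insw u c) = (count P u + P c)%N.
Proof. by case: u => //= c0 cs _; rewrite count_ins addnCA addnC. Qed.

Lemma wprod_cons2 c0 c1 cs : wp (c0 :: c1 :: cs) = lnprod (lie (x_ c0) (x_ c1)) cs.
Proof. by []. Qed.

(** If [c] is at least the second letter c1, permuting the tail is enough. Otherwise Jacobi gives c0
    c1 c = c0 c c1 - c1 c c0, and the last word is smaller because it starts with c1 < c0. *)
Lemma lie_wprod_letter u c : regular_word u -> (1 < size u)%N ->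
  lie (wp u) (x_ c) = wp (insw u c) \/
  exists u' : seq Z, [/\ regular_word u', word_lt u' (insw u c),
    perm_eq u' (insw u c) & lie (wp u) (x_ c) = wp (insw u c) - wp u'].
Proof.
case: u => [|c0 [|c1 cs]] // /andP[c10 scs] _.
rewrite wprod_cons2 -lnprod_lie /insw [ins c _]/=.
case: (ltgtP c c1) => [cc1|c1c|->].
- right; exists (c1 :: c :: ins c0 cs); split.
  + rewrite /= cc1 /= (path_min_sorted _) ?sorted_ins ?(path_sorted scs) //.
    apply/allP => e; rewrite (perm_mem (perm_ins _ _)) inE => /orP[/eqP ->|ecs].
      by rewrite ltW // (lt_trans cc1).
    have /allP/(_ _ ecs) := order_path_min le_trans scs.
    by apply: le_trans; rewrite ltW.
  + by rewrite word_lt_cons /= size_ins ltnn eqxx c10.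
  + apply/permP => p; rewrite /= count_ins.
    by rewrite addnCA [(p c1 + _)%N]addnCA addnCA.
  + rewrite lieAC lnprodB; congr (_ - _).
    by rewrite wprod_cons2 -lnprod_cons; apply/lnprod_perm; rewrite perm_sym perm_ins.
- left; rewrite -lnprod_cons; apply: lnprod_perm.
  by rewrite perm_sym perm_ins.
- by left.
Qed.

Lemma wprod_der1 u : (1 < size u)%N -> der1 (wp u).
Proof. by case: u => [|c0 [|c1 cs]] // _; apply: lnprod_der1. Qed.

Lemma lie_der1 f g : der1 f -> der1 g -> lie f g = 0.
Proof. by move=> [f1 [f2 ->]] [g1 [g2 ->]]; rewrite lie_metab. Qed.

(** The span contains the letters and is closed under brackets: two words of length at least 2 have
    product 0, and a product by a letter is rewritten by [lie_wprod_letter]. *)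
Lemma regular_span f : lin_span (range (fun v : word Z => wp v)) f.
Proof.
have Ws := lin_span_subspace (range (fun v : word Z => wp v)).
have [W0 WD WZ] := Ws.
pose W := lin_span (range (fun v : word Z => wp v)).
have Wr u : regular_word u -> W (wp u).
  by move=> ru; apply: lin_span_gen; exists (Word ru).
have WN g : W g -> W (- g) by move=> Wg; rewrite -scaleN1r; apply: WZ.
have Wlr u c : regular_word u -> W (lie (wp u) (x_ c)).
  case: u => [|b [|b' u]] // ru.
    change (wp [:: b]) with (x_ b).
    case: (ltgtP b c) => [bc|cb|->]; last by rewrite lie_alt.
      by rewrite lieC; apply/WN/(Wr [:: c; b]); rewrite /= bc.
    by apply: (Wr [:: b; c]); rewrite /= cb.
  case: (lie_wprod_letter c ru) => [//|->|[u' [ru' _ _ ->]]].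
    by apply: Wr; apply: regular_insw.
  by apply: WD; [|apply: WN]; apply: Wr => //; apply: regular_insw.
have Wrr u u' : regular_word u -> regular_word u' -> W (lie (wp u) (wp u')).
  case: u' => [//|c [|c' u']] ru; first by move=> _; apply: Wlr.
  case: u ru => [//|b [|b' u]] ru ru'.
    by rewrite lieC; apply: WN; apply: Wlr.
  by rewrite lie_der1 //; apply: wprod_der1.
move: f; apply: free_metab_ind => // [f g Wf Wg|z]; last exact: (Wr [:: z]).
move: f Wf; apply: lin_span_ind => [|_ [u _ <-]].
  split=> [|f f'|c f] /=; rewrite ?lie0l ?lieDl ?lieZl //; first exact: WD.
  exact: WZ.
move: g Wg; apply: lin_span_ind => [|_ [u' _ <-]]; last by apply: Wrr; apply: wseqP.
split=> [|g g'|c g] /=; rewrite ?lie0r ?lieDr ?lieZr //; first exact: WD.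
exact: WZ.
Qed.

End RegularWords.

(** * Regular words form a basis; coefficients and the two parts of a polynomial *)

Section Coefficients.
Variables (k : fieldType) (d : Order.disp_t) (Z : orderType d).
Local Notation L := (free_metab k Z).
Local Notation x_ := (@gen k Z).
Local Notation wp := (@wprod k d Z).
Local Notation we := (fun v : word Z => wp v).
Implicit Types (f g h : L) (v : word Z).

(** [coef] picks coordinates by choice, so even its additivity rests on their uniqueness. The
    functionals of [word_coef_exists] supply it, since they recover any finitely supported
    coordinates. *)
Lemma coef_dual : (forall v f g, coef (f + g) v = coef f v + coef g v) /\
  (forall v c f, coef (c *: f) v = c * coef f v) /\
  (forall u v : word Z, coef (wp u) v = (u == v)%:R) /\
  (forall f, fin_supp (coef f) /\ f = lincomb we (coef f)).
Proof.
have [wc [wcD wcZ wcE]] := word_coef_exists k Z.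
have wc0 (v : seq Z) : wc v 0 = 0 by rewrite -(scale0r 0) wcZ mul0r.
have wc_sum (T : Type) (s : seq T) (F : T -> L) (v : seq Z) :
    wc v (\sum_(t <- s) F t) = \sum_(t <- s) wc v (F t).
  by elim: s => [|t s IH]; rewrite ?big_nil ?wc0 // !big_cons wcD IH.
have wc_lincomb (p : word Z -> k) v : fin_supp p -> wc v (lincomb we p) = p v.
  move=> /fin_supp_seq[s us sE]; rewrite (lincombE _ us) ?wc_sum => [|t]; last by rewrite sE.
  under eq_bigr => t _ do rewrite wcZ wcE.
  have [vs|] := boolP (v \in s).
    rewrite (bigD1_seq v) //= eqxx mulr1 big1 ?addr0 // => t /negbTE ->.
    by rewrite mulr0.
  rewrite sE negbK => /eqP pv; rewrite pv big1_seq // => t /andP[_ ts].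
  by case: (t =P v) => [->|_]; rewrite ?mulr0 // pv mul0r.
have coefP f : fin_supp (coef f) /\ f = lincomb we (coef f).
  exact: coordsP (regular_span f).
have coefE f v : coef f v = wc v f.
  by have [ff E] := coefP f; rewrite [in RHS]E wc_lincomb.
split; first by move=> v f g; rewrite !coefE.
split; first by move=> v c f; rewrite !coefE.
by split=> [u v|f]; [rewrite coefE; apply: wcE | apply: coefP].
Qed.

Lemma wcoefD f g v : coef (f + g) v = coef f v + coef g v.
Proof. by have [+ _] := coef_dual; apply. Qed.
Lemma wcoefZ c f v : coef (c *: f) v = c * coef f v.
Proof. by have [_ [+ _]] := coef_dual; apply. Qed.
Lemma coef_wprod (u v : word Z) : coef (wp u) v = (u == v)%:R.
Proof. by have [_ [_ [+ _]]] := coef_dual; apply. Qed.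
Lemma coefP f : fin_supp (coef f) /\ f = lincomb we (coef f).
Proof. by have [_ [_ [_ +]]] := coef_dual; apply. Qed.
Lemma wcoefN f v : coef (- f) v = - coef f v.
Proof. by rewrite -scaleN1r wcoefZ mulN1r. Qed.
Lemma wcoefB f g v : coef (f - g) v = coef f v - coef g v.
Proof. by rewrite wcoefD wcoefN. Qed.
Lemma wcoef0 v : coef (0 : L) v = 0.
Proof. by rewrite -(subrr 0) wcoefB subrr. Qed.

Lemma coef_lincomb (p : word Z -> k) v : fin_supp p -> coef (lincomb we p) v = p v.
Proof.
move=> /fin_supp_seq[s us sE]; rewrite (lincombE _ us) => [|t]; last by rewrite sE.
have -> : coef (\sum_(t <- s) p t *: wp t) v = \sum_(t <- s) p t * (t == v)%:R.
  elim: s {us sE} => [|t s IH]; rewrite ?big_nil ?wcoef0 //.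
  by rewrite !big_cons wcoefD wcoefZ coef_wprod IH.
have [vs|] := boolP (v \in s).
  rewrite (bigD1_seq v) //= eqxx mulr1 big1 ?addr0 // => t /negbTE ->.
  by rewrite mulr0.
rewrite sE negbK => /eqP pv; rewrite pv big1_seq // => t /andP[_ ts].
by case: (t =P v) => [->|_]; rewrite ?mulr0 // pv mul0r.
Qed.

Lemma word_subspace Q f : subspace Q -> (forall v, coef f v != 0 -> Q (wp v)) -> Q f.
Proof. by move=> Qs Qv; have [ff ->] := coefP f; apply: lincomb_subspace. Qed.

Lemma coef_eq0 f : (forall v, coef f v = 0) -> f = 0.
Proof.
move=> f0; apply: (word_subspace (Q := [set 0])) => [|v]; last by rewrite f0 eqxx.
by split=> [//|_ _ -> ->|c _ ->]; rewrite ?addr0 ?scaler0.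
Qed.

Lemma part_fin f (b : pred (word Z)) : fin_supp (fun v => if b v then coef f v else 0).
Proof.
have [/fin_supp_seq[s _ sE] _] := coefP f.
by apply: (@seq_fin_supp _ _ _ s) => v; rewrite sE; case: ifP; rewrite ?eqxx.
Qed.

Lemma coef_part0 f v : coef (part0 f) v = if (size v == 1)%N then coef f v else 0.
Proof. by rewrite coef_lincomb //; apply: part_fin. Qed.

Lemma coef_part1 f v : coef (part1 f) v = if (1 < size v)%N then coef f v else 0.
Proof. by rewrite coef_lincomb //; apply: part_fin. Qed.

Lemma part01 f : f = part0 f + part1 f.
Proof.
apply/eqP; rewrite -subr_eq0; apply/eqP/coef_eq0 => v.
rewrite wcoefB wcoefD coef_part0 coef_part1.
by case: v => -[|c [|c1 v]] //= rv; rewrite ?addr0 ?add0r subrr.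
Qed.

End Coefficients.

(** * Leading words together with homogeneity in the letters of [P] *)

Section LeadingTerms.
Variables (k : fieldType) (d : Order.disp_t) (Z : orderType d) (P : pred Z).
Local Notation L := (free_metab k Z).
Local Notation x_ := (@gen k Z).
Local Notation wp := (@wprod k d Z).
Implicit Types (f g h : L) (u w cs ds : seq Z) (v : word Z) (a b c : Z).

(** [P] will be [is_x]. Comparing only words of equal [P]-degree lets one estimate carry both the
    order and the X-homogeneity. *)
Definition prec u w : bool := word_lt u w && (count P u == count P w).

Lemma prec_trans : transitive prec.
Proof.
move=> v u w /andP[uv /eqP cuv] /andP[vw /eqP cvw].
by rewrite /prec (word_lt_trans uv vw) cuv cvw eqxx.
Qed.

Definition low w : set L := [set f | forall v, coef f v != 0 -> prec v w].

Definition homog n : set L := [set f | forall v, coef f v != 0 -> count P v = n].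

Lemma supp_subspace (B : pred (word Z)) :
  subspace [set f : L | forall v, coef f v != 0 -> B v].
Proof.
split=> [v|f g fB gB v|c f fB v]; first by rewrite wcoef0 eqxx.
  rewrite wcoefD; have [->|/fB //] := eqVneq (coef f v) 0.
  by rewrite add0r; apply: gB.
by rewrite wcoefZ mulf_eq0 negb_or => /andP[_]; apply: fB.
Qed.

Lemma low_subspace w : subspace (low w).
Proof. exact: supp_subspace. Qed.

Lemma homog_subspace n : subspace (homog n).
Proof.
have -> : homog n = [set f | forall v, coef f v != 0 -> count P v == n].
  by apply/seteqP; split=> f fn v /fn/eqP.
exact: (supp_subspace (fun v : word Z => count P v == n)).
Qed.

Lemma low_wprod v w : prec v w -> low w (wp v).
Proof. by move=> vw v'; rewrite coef_wprod; case: (v =P v') => [<- //|_]; rewrite eqxx. Qed.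

Lemma homog_wprod v : homog (count P v) (wp v).
Proof. by move=> v'; rewrite coef_wprod; case: (v =P v') => [<- //|_]; rewrite eqxx. Qed.

Lemma low_ind Q w : subspace Q -> (forall v, prec v w -> Q (wp v)) -> low w `<=` Q.
Proof. by move=> Qs Qv f fw; apply: word_subspace => // v /fw /Qv. Qed.

Lemma homog_ind Q n : subspace Q -> (forall v, count P v = n -> Q (wp v)) ->
  homog n `<=` Q.
Proof. by move=> Qs Qv f fw; apply: word_subspace => // v /fw /Qv. Qed.

Lemma low_trans u w : prec u w -> low u `<=` low w.
Proof. by move=> uw f fu v /fu vu; apply: prec_trans uw. Qed.

Lemma low_homog w : low w `<=` homog (count P w).
Proof. by move=> f fw v /fw /andP[_ /eqP]. Qed.

(** For regular [u] this says at once that [f] is monic, has leading word [u] and is homogeneous. In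
    a difference of two such polynomials the word [u] cancels, which is how compositions fall below
    [w]. *)
Definition top u : set L := [set f | low u (f - wp u)].

Lemma topB u f g : top u f -> top u g -> low u (f - g).
Proof.
move=> tf tg; have := subspaceB (low_subspace u) tf tg.
by rewrite opprB addrA subrK.
Qed.

Lemma top_homog u f : regular_word u -> top u f -> homog (count P u) f.
Proof.
move=> ru tf; have [_ hD _] := homog_subspace (count P u).
rewrite -(subrK (wp u) f); apply: hD; first exact: low_homog.
exact: (@homog_wprod (Word ru)).
Qed.

Lemma top_leading u f : regular_word u -> top u f -> leading f 1 u.
Proof.
move=> ru tf; have cu : coef f (Word ru) = 1.
  have : coef (f - wp u) (Word ru) == 0.
    by apply/negPn/negP => /tf /andP[]; rewrite word_lt_irr.
  by rewrite wcoefB (@coef_wprod _ _ _ (Word ru)) eqxx subr_eq0 => /eqP.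
exists (Word ru); split; rewrite ?oner_eq0 // => v fv vu.
have : coef (f - wp u) v != 0.
  by rewrite wcoefB (@coef_wprod _ _ _ (Word ru)) [Word ru == v]eq_sym (negbTE vu) subr0.
by move/tf => /andP[].
Qed.

Lemma leading_low f (c : k) u n : leading f c u -> homog n f -> low u (f - c *: wp u).
Proof.
move=> [v [<- fv c0 lt]] hf v'; rewrite wcoefB wcoefZ coef_wprod.
have [<-|vv'] := eqVneq v v'; first by rewrite mulr1 fv subrr eqxx.
rewrite mulr0 subr0 => fv'; rewrite /prec lt // eq_sym //=.
by rewrite !(hf _ _) // fv.
Qed.

Lemma leading_top f u n : leading f 1 u -> homog n f -> top u f.
Proof. by move=> lf hf; have := leading_low lf hf; rewrite scale1r. Qed.

Lemma prec_insw c u w : (1 < size w)%N -> regular_word u -> (0 < size u)%N ->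
  prec u w -> prec (insw u c) (insw w c).
Proof.
move=> sw ru su /andP[uw cuw]; rewrite /prec !count_insw ?(ltnW sw) // eqn_add2r cuw.
case: u ru su uw {cuw} => // a u _ _; case: w sw => // b w _.
rewrite /insw !word_lt_cons !size_ins ltnS eqSS.
case/orP=> [->//|/andP[-> /orP[->|/andP[-> /(word_lt_ins c) ->]]]]; by rewrite !orbT.
Qed.

Lemma lie_letters_homog a b :
  lie (x_ a) (x_ b) = 0 \/ exists (e : k) v, [/\ size v = 2, count P v = (P a + P b)%N
    & lie (x_ a) (x_ b) = e *: wp v].
Proof.
case: (ltgtP a b) => [ab|ba|->]; last by left; rewrite lie_alt.
  have rv : regular_word [:: b; a] by rewrite /= ab.
  right; exists (-1), (Word rv); split=> //=; first by rewrite addn0 addnC.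
  by rewrite scaleN1r lieC.
have rv : regular_word [:: a; b] by rewrite /= ba.
by right; exists 1, (Word rv); split; rewrite /= ?addn0 // scale1r.
Qed.

Lemma low_lie c w f : regular_word w -> (1 < size w)%N ->
  low w f -> low (insw w c) (lie f (x_ c)).
Proof.
move=> rw sw; move: f; apply: low_ind => [|v vw].
  have [l0 lD lZ] := low_subspace (insw w c).
  by split=> [|f g|e f] /=; rewrite ?lie0l ?lieDl ?lieZl //; [apply: lD|apply: lZ].
have [l0 lD lZ] := low_subspace (insw w c).
have [/andP[ltvw /eqP cvw] rv] := (vw, wseqP v).
have [sv|sv] := ltnP 1 (size v).
  have vwc : prec (insw v c) (insw w c).
    by apply: prec_insw => //; apply: ltnW.
  have riv := regular_insw c rv sv.
  have lv : low (insw w c) (wp (insw v c)) := @low_wprod (Word riv) _ vwc.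
  case: (lie_wprod_letter k c rv sv) => [->//|[u [ru uv pu ->]]].
  apply: (subspaceB (low_subspace _)) => //; apply: (@low_wprod (Word ru)).
  by apply: prec_trans vwc; rewrite /prec uv (permP pu) eqxx.
(* A single letter times [c] has length at most 2, while [insw w c] has at least three letters. *)
case: v sv rv {vw} ltvw cvw => -[|a [|//]] // rv _ _ ltvw cvw.
change (wp _) with (x_ a).
have [->//|[e [v [sv cv ->]]]] := lie_letters_homog a c.
apply/lZ/low_wprod; rewrite /prec cv count_insw ?(ltnW sw) // -cvw /= addn0 eqxx.
by rewrite word_lt_size // sv size_insw ?(ltnW sw).
Qed.

Lemma top_lie c w f : regular_word w -> (1 < size w)%N ->
  top w f -> top (insw w c) (lie f (x_ c)).
Proof.
move=> rw sw tf; rewrite /top /= -(subrK (wp w) f) lieDl.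
have [l0 lD lZ] := low_subspace (insw w c).
rewrite -addrA; apply: lD; first exact: low_lie.
have riv := regular_insw c rw sw.
case: (lie_wprod_letter k c rw sw) => [->|[u [ru uv pu ->]]]; first by rewrite subrr.
rewrite addrAC subrr sub0r -scaleN1r; apply/lZ/(@low_wprod (Word ru)).
by rewrite /prec uv (permP pu) eqxx.
Qed.

Lemma top_lnprod c0 s cs f : regular_word (c0 :: s) -> s != [::] ->
  top (c0 :: s) f -> top (c0 :: sort <=%O (s ++ cs)) (lnprod f cs).
Proof.
elim/last_ind: cs => [|cs c IH] rs s0 tf.
  by rewrite cats0 sorted_sort //; [exact: le_trans | case: (regular_cons rs)].
rewrite lnprod_rcons.
have rs' : regular_word (c0 :: sort <=%O (s ++ cs)).
  have: sorted <=%O (sort <=%O (s ++ cs)) by exact/sort_sorted/le_total.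
  case E: (sort _ _) => [|c1 r] //= ->; rewrite andbT.
  have sc1 : (c1 <= head c0 s)%O.
    have : head c0 s \in c1 :: r.
      by rewrite -E mem_sort mem_cat; case: s s0 {rs tf IH E} => //= e s _; rewrite mem_head.
    have : sorted <=%O (c1 :: r) by rewrite -E; exact/sort_sorted/le_total.
    move=> /(order_path_min le_trans)/allP min; rewrite inE => /orP[/eqP -> //|].
    exact: min.
  by case: s s0 rs sc1 {tf IH E} => //= e s _ /andP[ec0 _] /le_lt_trans; apply.
have ss' : (1 < size (c0 :: sort <=%O (s ++ cs)))%N.
  by rewrite /= size_sort size_cat; case: s s0 {rs tf IH rs'}.
have := @top_lie c _ _ rs' ss' (IH rs s0 tf).
suff -> : insw (c0 :: sort <=%O (s ++ cs)) c = c0 :: sort <=%O (s ++ rcons cs c) by [].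
congr (_ :: _); apply: sorted_perm.
- exact/sorted_ins/sort_sorted/le_total.
- exact/sort_sorted/le_total.
- rewrite (perm_trans (perm_ins _ _)) // perm_sym perm_sort -cats1 catA cats1.
  by rewrite perm_rcons perm_cons perm_sym perm_sort.
Qed.

End LeadingTerms.

(** * Compositions of homogeneous polynomials lie below [w] *)

Section Compositions.
Variables (k : fieldType) (d : Order.disp_t) (Z : orderType d) (P : pred Z).
Local Notation L := (free_metab k Z).
Local Notation x_ := (@gen k Z).
Local Notation wp := (@wprod k d Z).
Local Notation low := (low P).
Local Notation homog := (homog P).
Local Notation top := (top P).
Implicit Types (f g h : L) (u w cs ds : seq Z) (v : word Z) (a b c : Z).

Lemma homog_word_lie u c : regular_word u -> (0 < size u)%N ->
  homog (count P u + P c)%N (lie (wp u) (x_ c) : L).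
Proof.
case: u => [|b [|c1 cs]] // ru _; set u := b :: _.
  have [h0 hD hZ] := homog_subspace k P (count P u + P c)%N.
  change (wp u) with (x_ b).
  have [->//|[e [v [_ cv ->]]]] := lie_letters_homog k P b c.
  by apply: hZ; rewrite /u /= addn0 -cv; apply: homog_wprod.
have ri := @regular_insw _ _ u c ru isT; rewrite -count_insw //.
have hi : homog (count P (insw u c)) (wp (insw u c) : L) := @homog_wprod k d Z P (Word ri).
have [->//|[u' [ru' _ pu ->]]] := @lie_wprod_letter k _ _ u c ru isT.
apply: (subspaceB (homog_subspace k P _)) => //.
by rewrite -(permP pu); apply: (@homog_wprod k d Z P (Word ru')).
Qed.

Lemma lie_subspace_l (Q : set L) g : subspace Q -> subspace [set f | Q (lie f g)].
Proof.
by case=> Q0 QD QZ; split=> [|f f'|e f] /=; rewrite ?lie0l ?lieDl ?lieZl //; [apply: QD|apply: QZ].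
Qed.

Lemma lie_subspace_r (Q : set L) g : subspace Q -> subspace [set f | Q (lie g f)].
Proof.
by case=> Q0 QD QZ; split=> [|f f'|e f] /=; rewrite ?lie0r ?lieDr ?lieZr //; [apply: QD|apply: QZ].
Qed.

Lemma homog_lie n f c : homog n f -> homog (n + P c)%N (lie f (x_ c)).
Proof.
move: f; apply: homog_ind => [|v <-]; first exact/lie_subspace_l/homog_subspace.
by apply: homog_word_lie; [exact: wseqP | case: v => -[]].
Qed.

Lemma homog_lnprod n f cs : homog n f -> homog (n + count P cs)%N (lnprod f cs).
Proof.
elim/last_ind: cs => [|cs c IH] hf; first by rewrite addn0.
by rewrite lnprod_rcons -cats1 count_cat /= addn0 addnA; apply/homog_lie/IH.
Qed.

Lemma homog_lie_word n u g : regular_word u -> (1 < size u)%N ->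
  homog n g -> homog (count P u + n)%N (lie (wp u) g).
Proof.
move=> ru su; move: g; apply: homog_ind => [|v <-].
  exact/lie_subspace_r/homog_subspace.
case: v => -[|c [|c1 cs]] // rv /=.
  by rewrite addn0; apply: homog_word_lie => //; apply: ltnW.
rewrite lie_der1; [by have [] := homog_subspace k P (count P u + (P c + (P c1 + count P cs)))%N | |].
  exact: wprod_der1.
exact: lnprod_der1.
Qed.

Lemma word_lt_ins_letter a c cs : sorted <=%O cs -> (a < c)%O ->
  word_lt (ins a cs) (ins c cs).
Proof.
elim: cs => [_ ac|b cs IH bcs ac] /=; first by rewrite word_lt_cons /= ac.
case: (ltgtP a b) => [ab|ba|E].
  by case: ifP => _; rewrite word_lt_cons /= ?size_ins eqxx ?ac ?ab ?ltnn.
  by rewrite leNgt (lt_trans ba ac) /= word_lt_cons !size_ins !eqxx ltnn IH ?(path_sorted bcs) // orbT.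
rewrite E leNgt -E ac /= word_lt_cons /= size_ins eqxx ltnn eqxx ltxx /=.
have <- : ins a cs = a :: cs; last by apply: IH; rewrite ?(path_sorted bcs).
by apply: ins_head; case: cs bcs {IH} => //= b' cs; rewrite E => /andP[].
Qed.

Lemma prec_insw_letter u a c : regular_word u -> (0 < size u)%N ->
  (a < c)%O -> P a = P c :> nat -> prec P (insw u a) (insw u c).
Proof.
move=> ru su ac Pac; rewrite /prec !count_insw // Pac eqxx andbT.
case: u ru su => // c0 cs /regular_cons[scs _] _.
by rewrite word_lt_cons !size_ins ltnn !eqxx ltxx word_lt_ins_letter.
Qed.

(** The derived algebra is abelian, so the (1)-part of [g] annihilates the word. *)
Lemma lie_part0 u g : (1 < size u)%N -> lie (wp u) g = lie (wp u) (part0 g).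
Proof.
move=> su; rewrite [in LHS](part01 g) lieDr [X in _ + X](_ : _ = 0) ?addr0 //.
apply: (word_subspace (Q := [set f | lie (wp u) f = 0])) => [|v].
  apply: (lie_subspace_r (Q := [set 0])).
  by split=> [//|_ _ -> ->|e _ ->] /=; rewrite ?addr0 ?scaler0.
rewrite coef_part1; case: ifP => [sv _|_]; last by rewrite eqxx.
by apply: lie_der1; apply: wprod_der1.
Qed.

Lemma homog_part0 n g : homog n g -> homog n (part0 g).
Proof.
by move=> hg v; rewrite coef_part0; case: ifP => [_ /hg //|]; rewrite eqxx.
Qed.

(** Only the letters of [part0 g] act on the word, and inserting a smaller letter gives a smaller
    word. The largest letter [c], of coefficient [beta], therefore yields the top term. *)
Lemma lie_word_top u c beta n g : regular_word u -> (1 < size u)%N ->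
  homog n g -> leading (part0 g) beta [:: c] ->
  top (insw u c) (beta^-1 *: lie (wp u) g).
Proof.
move=> ru su hg lg; have [b0 lowg] : beta != 0 /\ low [:: c] (part0 g - beta *: x_ c).
  split; first by case: lg => v [].
  exact: (leading_low lg (homog_part0 hg)).
rewrite lie_part0 //; have [l0 lD lZ] := low_subspace k P (insw u c).
rewrite -(subrK (beta *: x_ c) (part0 g)) lieDr lieZr scalerDr scalerA mulVf // scale1r.
have tu a : top (insw u a) (lie (wp u) (x_ a)).
  apply: top_lie => //; rewrite /top /= subrr; by have [] := low_subspace k P u.
rewrite /top /= -addrA; apply: lD; last exact: tu.
apply: lZ; move: (_ - _) lowg; apply: low_ind => [|v].
  exact/lie_subspace_r/low_subspace.
case: v => -[|a [|a1 v]] // rv /andP[]; rewrite word_lt_cons //= andbF orbF addn0 => ac /eqP Pac.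
change (wp [:: a]) with (x_ a); rewrite -(subrK (wp (insw u a)) (lie _ _)).
have pac : prec P (insw u a) (insw u c).
  by apply: prec_insw_letter; rewrite ?(ltnW su) // Pac addn0.
have [_ lD' _] := low_subspace k P (insw u c).
apply: lD'; first exact: low_trans (tu a).
exact: (@low_wprod _ _ _ _ (Word (regular_insw a ru su))).
Qed.

Lemma sorted_letters_lcm (cs ds : seq Z) (l := (seq_mset cs `|` seq_mset ds)%mset) :
  sort <=%O (cs ++ sorted_letters (l `\` seq_mset cs)%mset) = sorted_letters l /\
  sort <=%O (ds ++ sorted_letters (l `\` seq_mset ds)%mset) = sorted_letters l.
Proof.
have main es : (forall c, seq_mset es c <= l c)%N ->
    sort <=%O (es ++ sorted_letters (l `\` seq_mset es)%mset) = sorted_letters l.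
  move=> esl; apply: sorted_perm; rewrite ?sort_sorted //; try exact: le_total.
  rewrite perm_sort perm_sym perm_sort; apply/allP => c _ /=; apply/eqP.
  rewrite count_cat (permP (permEl (perm_sort _ _))) !count_mem_mset msetE2.
  by move: (esl c); rewrite mset_seqE => /subnKC.
by split; apply: main => c; rewrite msetE2 ?leq_maxl ?leq_maxr.
Qed.

(* [composition] is analysed only between polynomials whose leading words have
   length at least 2, which excludes type III. *)
Lemma composition_low f g w h n m : homog n f -> homog m g ->
  (forall u, leading_word f u -> (1 < size u)%N) ->
  (forall u, leading_word g u -> (1 < size u)%N) ->
  composition f g w h -> low w h.
Proof.
move=> hf hg sf sg.
have reg f' (e : k) u : leading f' e u -> regular_word u by move=> [v [<- _ _ _]]; exact: wseqP.
have ltop f' n' u : homog n' f' -> leading f' 1 u -> top u f' by move=> hf' lf; apply: leading_top lf hf'.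
have sizef (e : k) u : leading f e u -> (1 < size u)%N by move=> lf; apply: sf; exists e.
have sizeg (e : k) u : leading g e u -> (1 < size u)%N by move=> lf; apply: sg; exists e.
(* In every type except III the composition is a difference of two polynomials with top word [w];
   each case identifies [w] with the words obtained from both sides. *)
case=> {w h}.
- move=> c0 cs ds l lf lg; have [el er] := sorted_letters_lcm cs ds.
  have cs0 : cs != [::] by case: (cs) lf => // /sizef.
  have ds0 : ds != [::] by case: (ds) lg => // /sizeg.
  have tf := @top_lnprod _ _ _ P c0 cs (sorted_letters (l `\` seq_mset cs)%mset) f
    (reg _ _ _ lf) cs0 (ltop _ _ _ hf lf).
  have tg := @top_lnprod _ _ _ P c0 ds (sorted_letters (l `\` seq_mset ds)%mset) g
    (reg _ _ _ lg) ds0 (ltop _ _ _ hg lg).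
  by rewrite el in tf; rewrite er in tg; apply: topB.
- move=> c0 c1 cs c es beta lf lg; apply: topB; first exact: (ltop _ _ _ hf lf).
  have /andP[c10 sc] := reg _ _ _ lf.
  have sub : sorted <=%O (c1 :: cs ++ es).
    apply: (subseq_sorted le_trans _ sc); rewrite -!cat_cons.
    by apply: cat_subseq => //; apply: subseq_cons.
  have -> : c0 :: c1 :: cs ++ c :: es = insw (c0 :: c1 :: cs ++ es) c.
    congr (_ :: _); apply: sorted_perm => //; first exact: sorted_ins.
    by rewrite perm_sym (perm_trans (perm_ins _ _)) // -!cat_cons -[c :: es]cat1s perm_sym perm_catCA.
  by apply: lie_word_top hg lg; rewrite // /regular_word c10.
- move=> c0 c1 c2 cs beta lf lg c20; apply: topB; first exact: (ltop _ _ _ hf lf).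
  have /andP[c10 /andP[c12 sc]] := reg _ _ _ lf.
  have -> : [:: c0, c1, c2 & cs] = insw [:: c0, c2 & cs] c1.
    by rewrite /insw /= c12.
  by apply: lie_word_top hg lg; rewrite // /regular_word c20.
- by move=> c0 c1 cs _ lg; have := sizeg _ _ lg.
- move=> c0 c1 cs beta c lf g1 lg c02 cc0.
  have rf := reg _ _ _ lf; have /andP[c10 sc] := rf.
  have -> : c0 :: sort <=%O [:: c, c1 & cs] = insw [:: c0, c1 & cs] c.
    by rewrite /insw sort_ins.
  apply: topB; first by apply: top_lie => //; exact: (ltop _ _ _ hf lf).
  have sccs : sorted <=%O (c :: cs).
    case: (cs) c02 sc => //= c2 cs' c02 /andP[_ ->].
    by rewrite (le_trans (ltW cc0)).
  have -> : insw [:: c0, c1 & cs] c = insw [:: c0, c & cs] c1.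
    congr (_ :: _); apply: sorted_perm; rewrite ?sorted_ins //.
    rewrite (perm_trans (perm_ins _ _)) // perm_sym (perm_trans (perm_ins _ _)) //.
    by rewrite -(cat1s c1) -(cat1s c) perm_catCA.
  by apply: lie_word_top hg lg => //; rewrite /regular_word cc0.
- move=> c0 c1 cs beta e lf _ _ lg _; have rf := reg _ _ _ lf.
  have /andP[c10 sc] := rf.
  have -> : c0 :: sort <=%O [:: e, c1 & cs] = insw [:: c0, c1 & cs] e.
    by rewrite /insw sort_ins.
  apply: topB; first by apply: top_lie => //; exact: (ltop _ _ _ hf lf).
  exact: lie_word_top hg lg.
- move=> c alpha beta c0 c1 lf lg _ c10.
  have -> : c0 :: sort <=%O [:: c1; c] = insw [:: c0; c1] c.
    congr (_ :: _); apply: sorted_perm; [exact/sort_sorted/le_total|exact: sorted_ins|].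
    by rewrite perm_sort perm_sym (perm_trans (perm_ins _ _)) // perm_sym (perm_catC [:: c1] [:: c]).
  rewrite lieBr !lieZr; apply: topB.
    by apply: lie_word_top hf lf; rewrite //= c10.
  by apply: lie_word_top hg lg; rewrite //= c10.
- move=> c e alpha beta c0 _ _ lf lg ec cc0; apply: topB.
    have -> : [:: c0; e; c] = insw [:: c0; e] c by rewrite /insw /= leNgt ec.
    by apply: lie_word_top hf lf; rewrite //= (lt_trans ec).
  have -> : [:: c0; e; c] = insw [:: c0; c] e by rewrite /insw /= ltW.
  by apply: lie_word_top hg lg; rewrite //= cc0.
Qed.

End Compositions.

(** * Complete remainders and Shirshov's algorithm *)

Section Shirshov.
Variables (k : fieldType) (d : Order.disp_t) (Z : orderType d) (P : pred Z).
Hypothesis wfZ : well_founded (fun a b : Z => (a < b)%O).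
Local Notation L := (free_metab k Z).
Local Notation x_ := (@gen k Z).
Local Notation wp := (@wprod k d Z).
Local Notation low := (low P).
Local Notation homog := (homog P).
Implicit Types (f g h p q r : L) (u w : seq Z) (v : word Z) (S : set L).

Lemma leading_exists f : f <> 0 -> exists v c, leading f c v.
Proof.
move=> f0; have [/fin_supp_seq[s _ sE] _] := coefP f.
have [v vs vmax] : exists2 v, v \in s & forall v', v' \in s -> v' != v -> word_lt v' v.
  have : s != [::].
    by apply/eqP => s0; apply/f0/coef_eq0 => v; apply/eqP; rewrite -[_ == _]negbK -sE s0.
  elim: s {sE} => // v s IH _; have [->|/IH[v' v's vmax]] := eqVneq s [::].
    by exists v; rewrite ?mem_head // => v'; rewrite inE => ->.
  case/or3P: (word_lt_total v v') => [vv'|/eqP/val_inj vv'|v'v].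
  - exists v'; rewrite ?inE ?v's ?orbT // => v2; rewrite inE => /orP[/eqP -> //|].
    exact: vmax.
  - exists v'; rewrite ?inE ?v's ?orbT // => v2; rewrite inE => /orP[/eqP ->|].
      by rewrite vv' eqxx.
    exact: vmax.
  - exists v; rewrite ?mem_head // => v2; rewrite inE => /orP[-> //|v2s _].
    have [->//|v2v'] := eqVneq v2 v'.
    exact: word_lt_trans (vmax _ v2s v2v') v'v.
exists v, (coef f v), v; split=> //; first by rewrite -sE.
by move=> v'; rewrite -sE; apply: vmax.
Qed.

Lemma leading_uniq f c c' u u' : leading f c u -> leading f c' u' -> u = u' /\ c = c'.
Proof.
move=> [v [<- fv c0 lt]] [v' [<- fv' c0' lt']]; suff vv' : v = v'.
  by rewrite -fv -fv' vv'.
apply/eqP; apply/negPn/negP => vv'.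
have := word_lt_trans (lt v' _ _) (lt' v _ vv'); rewrite word_lt_irr fv' fv [v' == v]eq_sym.
by move/(_ c0' vv' c0).
Qed.

Lemma leadingZ f (a c : k) u : a != 0 -> leading f c u -> leading (a *: f) (a * c) u.
Proof.
move=> a0 [v [vu fv c0 lt]]; exists v; split; rewrite ?wcoefZ ?fv ?mulf_neq0 //.
by move=> v'; rewrite wcoefZ mulf_eq0 negb_or => /andP[_]; apply: lt.
Qed.

Definition homogeneous f := exists n, homog n f.

Lemma normal_word_homog S q : S `<=` homogeneous -> normal_word S q -> homogeneous q.
Proof.
move=> hS; case=> [f cs /hS[n hf] _ _|u f su /hS[n hf] _].
  by exists (n + count P cs)%N; apply: homog_lnprod.
by exists (count P u + n)%N; apply: homog_lie_word => //; apply: wseqP.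
Qed.

Lemma normal_wordS S S' : S `<=` S' -> normal_word S `<=` normal_word S'.
Proof.
move=> SS' q [f cs /SS' Sf scs h|u f su /SS' Sf h]; first exact: NormalL.
exact: NormalR.
Qed.

Lemma trivial_modS S S' w : S `<=` S' -> trivial_mod S w `<=` trivial_mod S' w.
Proof.
move=> SS'; apply: lin_spanS => q [nq lq]; split=> //.
exact: normal_wordS nq.
Qed.

(** Division in which the bound [w] on the normal words stays fixed while the bound [u] on the
    polynomial descends in the well-founded word order. Homogeneity of [S] ensures that subtracting
    a normal word creates no term of another degree. *)
Lemma remainder_exists S w p : S `<=` homogeneous -> low w p ->
  exists2 r, remainder S w p r & low w r.
Proof.
move=> hS; have [t0 tD tZ] := lin_span_subspace (normal_below S w).
suff main u : u = w \/ prec P u w -> forall q, low u q ->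
    exists2 r, remainder S w q r & low u r by apply: main; left.
elim/(well_founded_ind (word_lt_wf wfZ)): u => u IH uw q qu.
have [l0 lD lZ] := low_subspace k P u.
have [q0|] := EM (q = 0).
  exists 0; last exact: l0.
  by rewrite q0; split; [rewrite /trivial_mod subrr | move=> v; rewrite wcoef0 eqxx].
case/leading_exists => v [c lq].
have cq : coef q v != 0 by have [v' [/val_inj <- -> ? _]] := lq.
have vu := qu v cq; have /andP[ltvu _] := vu.
have vw : prec P v w by case: uw => [<- //|]; apply: prec_trans.
have lowv := leading_low lq (low_homog qu).
have IHv := IH v ltvu (or_intror vw).
have [[g [ng lg] [e ge]]|no] := EM (exists2 g, normal_below S w g & leading_word g v).
  have [n hg] := normal_word_homog hS ng.
  have e0 : e != 0 by have [? [_ _]] := ge.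
  have /IHv[r [qr irr] lr] : low v (q - (c / e) *: g).
    have [lv0 lvD lvZ] := low_subspace k P v.
    have -> : q - (c / e) *: g = (q - c *: wp v) - (c / e) *: (g - e *: wp v).
      by rewrite scalerBr scalerA divfK // opprB addrA subrK.
    by apply: (subspaceB (low_subspace k P v)) => //; apply/lvZ/(leading_low ge hg).
  exists r; last exact: low_trans lr.
  split=> //; rewrite -(subrK ((c / e) *: g) q) -addrA [_ - r]addrC addrA.
  by apply: tD => //; apply/tZ/lin_span_gen; split.
(* No admissible normal word has this leading word: the leading term moves into the remainder. *)
have [r [qr irr] lr] := IHv _ lowv.
exists (r + c *: wp v).
  split; first by rewrite opprD addrA addrAC.
  move=> v'; rewrite wcoefD wcoefZ coef_wprod; have [<- _ //|vv'] := eqVneq v v'.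
  by rewrite mulr0 addr0; apply: irr.
by apply: lD; [exact: low_trans lr | apply/lZ/low_wprod].
Qed.

Section Ideal.
Variable J : set L.
Hypothesis JI : lie_ideal J.

Lemma ideal_subspace : subspace J.
Proof. by case: JI. Qed.

Lemma ideal_lie f g : J f -> J (lie f g) /\ J (lie g f).
Proof. by case: JI => _ _ _; apply. Qed.

Lemma ideal_lnprod f cs : J f -> J (lnprod f cs).
Proof. by elim: cs f => // c cs IH f Jf; apply: IH; have [] := ideal_lie (x_ c) Jf. Qed.

Lemma normal_word_ideal S : S `<=` J -> normal_word S `<=` J.
Proof.
move=> SJ q [f cs /SJ Jf _ _|u f _ /SJ Jf _]; first exact: ideal_lnprod.
by have [] := ideal_lie (wp u) Jf.
Qed.

Lemma trivial_mod_ideal S w : S `<=` J -> trivial_mod S w `<=` J.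
Proof.
by move=> SJ; apply: lin_span_ind ideal_subspace _ => q [/(normal_word_ideal SJ)].
Qed.

Lemma composition_ideal f g w h : J f -> J g -> composition f g w h -> J h.
Proof.
move=> Jf Jg; have JB := subspaceB ideal_subspace; have [_ JD JZ] := ideal_subspace.
have Jr p q : J q -> J (lie p q) by move=> /(ideal_lie p)[].
have Jl p q : J q -> J (lie q p) by move=> /(ideal_lie p)[].
have Jn q cs := @ideal_lnprod q cs.
by case=> * ; [apply: JB; apply: Jn|apply: JB => //; apply/JZ/Jr|apply: JB => //; apply/JZ/Jr
  |apply: JD => //; apply: Jn|apply: JB; [exact: Jl|apply/JZ/Jr]
  |apply: JB; [exact: Jl|apply/JZ/Jr]|apply/Jr/JB; apply/JZ
  |apply: JB; apply/JZ/Jr].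
Qed.

End Ideal.

(** All nontrivial compositions are treated at once, and only complete remainders are added. The
    clause [low w r] records what later rounds need: the new element is homogeneous and lies below
    [w]. *)
Definition shirshov_round S : set L := S `|` [set h |
  exists f g w p r (c : k),
    [/\ S f /\ S g, composition f g w p, ~ trivial_mod S w p,
        remainder S w p r &
        [/\ c != 0, h = c *: r, Defs.monic h & low w r]]].

Lemma shirshov_round_step S : shirshov_step S (shirshov_round S).
Proof.
split=> [f|h []]; [by left | by left | right].
move: b => [f [g [w [p [r [c [Sfg fgp nt rem [c0 hE mh lr]]]]]]]].
by exists f, g, w, p, r, c; split=> //; right.
Qed.

Variable M : set L.
Hypothesis M_monic : M `<=` @Defs.monic k d Z.
Hypothesis M_homog : M `<=` homogeneous.
Hypothesis M_size : forall f u, ideal_gen M f -> leading_word f u -> (1 < size u)%N.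

Definition rounds n : set L := iter n shirshov_round M.

Lemma rounds_props n : rounds n `<=` ideal_gen M /\ rounds n `<=` @Defs.monic k d Z /\
  rounds n `<=` homogeneous.
Proof.
elim: n => [|n [IHi [IHm IHh]]]; first by split=> // f Mf J _; apply.
have step h : rounds n.+1 h -> rounds n h \/ [/\ ideal_gen M h, Defs.monic h & homogeneous h].
  case=> [|[f [g [w [p [r [c [[Sf Sg] fgp _ [triv _] [c0 -> mh lr]]]]]]]]]; [by left | right].
  have Is := ideal_subspace (ideal_gen_ideal M).
  have [_ _ IZ] := Is; split=> //.
    apply: IZ; rewrite -(subKr p r); apply: (subspaceB Is).
      exact: (composition_ideal (ideal_gen_ideal M) (IHi _ Sf) (IHi _ Sg) fgp).
    exact: (trivial_mod_ideal (ideal_gen_ideal M) IHi triv).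
  exists (count P w); have [_ _ hZ] := homog_subspace k P (count P w).
  exact/hZ/low_homog.
by split; [|split] => h /step[h'|[]] //; [exact: IHi|exact: IHm|exact: IHh].
Qed.

Lemma rounds_le m n : (m <= n)%N -> rounds m `<=` rounds n.
Proof.
move=> /subnK <-; elim: (n - m)%N => // j IH f /IH; by left.
Qed.

(** Two elements of the union of all rounds lie in a common round [j]; a composition that is
    nontrivial there has its remainder added in round [j.+1], hence is trivial modulo the union. *)
Lemma gs_complement_exists : exists S,
  [/\ gs_complement M S, M `<=` S &
    forall h, S h -> M h \/
      [/\ ideal_gen M h, homogeneous h, exists u, leading h 1 u
        & forall q u, normal_word M q -> leading_word q u -> ~ leading_word h u]].
Proof.
pose S := \bigcup_n rounds n; exists S.
have roundsS n : rounds n `<=` S by move=> f fn; exists n.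
have MS : M `<=` S := roundsS 0%N.
have SI : S `<=` ideal_gen M by move=> f [n _ /(proj1 (rounds_props n))].
have Sh : S `<=` homogeneous by move=> f [n _ /(proj2 (proj2 (rounds_props n)))].
have Sm : S `<=` @Defs.monic k d Z by move=> f [n _ /(proj1 (proj2 (rounds_props n)))].
split=> //.
  split.
  - split=> // f g w p [m _ fm] [n _ gn] fgp.
    pose j := maxn m n.
    have fj : rounds j f by apply: rounds_le fm; apply: leq_maxl.
    have gj : rounds j g by apply: rounds_le gn; apply: leq_maxr.
    have [t|nt] := EM (trivial_mod (rounds j) w p).
      exact: (trivial_modS (roundsS j)).
    have [_ [_ jh]] := rounds_props j.
    have [[nf hf] [ng hg]] := (jh _ fj, jh _ gj).
    have fI : ideal_gen M f by apply: SI; exists m.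
    have gI : ideal_gen M g by apply: SI; exists n.
    have lp := composition_low hf hg (fun u => M_size fI) (fun u => M_size gI) fgp.
    have [r rem lr] := remainder_exists jh lp.
    have [rtriv rirr] := rem.
    have [r0|] := EM (r = 0); first by case: nt; rewrite -[p]subr0 -r0.
    case/leading_exists => v [c lc].
    have c0 : c != 0 by case: lc => ? [].
    have lh : leading (c^-1 *: r) 1 v.
      by rewrite -(mulVf c0); apply: leadingZ => //; rewrite invr_eq0.
    have hS : S (c^-1 *: r).
      exists j.+1 => //; right; exists f, g, w, p, r, c^-1; split=> //.
      by split; rewrite ?invr_eq0 //; exists v.
    have [_ tD tZ] := lin_span_subspace (normal_below S w).
    (* The other summand [r] is a multiple of the element just added, which is itself a normal word
       (with no letters appended) below [w]. *)
    rewrite -(subrK r p); apply: tD; first exact: (trivial_modS (roundsS j)).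
    rewrite -[r](scalerKV c0); apply/tZ/lin_span_gen; split.
      exact: (@NormalL _ _ _ S _ [::]).
    exists v; first by exists 1.
    have [v' [/val_inj <- cv _ _]] := lc.
    by have /andP[] := lr v' (eq_ind_r (fun x => x != 0) c0 cv).
  - apply/seteqP; split=> f fI J JI SJ.
      by apply: fI => // g /SI; apply.
    by apply: fI => // g /MS /SJ.
  - exists rounds => //; split=> // n; exact: shirshov_round_step.
move=> h [n _]; elim: n => [|n IH]; first by left.
move=> hn; case: (hn) => [/IH //|[f [g [w [p [r [c [_ _ _ [_ irr] [c0 hE mh lr]]]]]]]]].
right; have [hI [_ hh]] := rounds_props n.+1; split; [exact: hI|exact: hh|exact: mh|].
move=> q u nq lq [e lh].
have [v [vu hv e0 _]] := lh.
have rv : coef r v != 0.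
  by apply: contraNneq e0 => r0; rewrite -hv hE wcoefZ r0 mulr0.
(* The remainder was taken modulo a round containing [M], so it is irreducible also for normal
   [M]-words. *)
case: (irr v rv); exists q; last by rewrite vu.
split; first exact: (normal_wordS (@rounds_le 0 n isT) nq).
by exists v; [rewrite vu | have /andP[] := lr v rv].
Qed.

End Shirshov.

(** * Leading words of the span of a triangular family *)

Section Triangular.
Variables (k : fieldType) (d : Order.disp_t) (Z : orderType d) (P : pred Z).
Local Notation L := (free_metab k Z).
Local Notation x_ := (@gen k Z).
Local Notation wp := (@wprod k d Z).
Implicit Types (f g h : L) (u w : seq Z) (v : word Z).

(** The passage from the words to the polynomials [beta] is unitriangular, so the leading term
    survives. *)
Lemma leading_lincomb (beta : word Z -> L) (p : word Z -> k) (c : k) u :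
  fin_supp p -> (forall v, p v != 0 -> top P v (beta v)) ->
  leading (lincomb (fun v : word Z => wp v) p) c u -> leading (lincomb beta p) c u.
Proof.
move=> fp tb [v [<- pv c0 lt]].
have lt' v' : p v' != 0 -> v' != v -> word_lt v' v.
  by rewrite -(coef_lincomb v' fp); apply: lt.
rewrite coef_lincomb // in pv.
have [s us sE] := fin_supp_seq fp.
pose Q : set L := [set f | forall v' : word Z, coef f v' != 0 -> word_lt v' v].
have Qs : subspace Q by apply: (@supp_subspace k d Z (fun v' : word Z => word_lt v' v)).
have [Q0 QD QZ] := Qs.
have lowQ u' : word_lt u' v \/ u' = v -> low P u' `<=` Q.
  move=> uv f fu v' /fu /andP[lv _]; case: uv => [|<- //].
  exact: word_lt_trans.
have Qf : Q (lincomb beta p - c *: wp v).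
  have vs : v \in s by rewrite sE pv.
  rewrite (lincombE _ us) => [|t]; last by rewrite sE.
  rewrite (bigD1_seq v) //= pv addrAC -scalerBr; apply: QD.
    by apply/QZ/(lowQ v); [right | apply: tb; rewrite pv].
  rewrite big_seq_cond; elim/big_rec: _ => [|t f /andP[ts tv] Qf]; first exact: Q0.
  have pt : p t != 0 by rewrite -sE.
  have ltv := lt' t pt tv.
  have [_ QD' _] := Qs; apply: QD' => //; have [_ _ QZ'] := Qs; apply: QZ'.
  rewrite -(subrK (wp t) (beta t)); have [_ QD'' _] := Qs; apply: QD''.
    by apply: (lowQ t); [left | apply: tb].
  by move=> v'; rewrite coef_wprod; case: (t =P v') => [<- //|]; rewrite eqxx.
exists v; have fE (v' : word Z) : coef (lincomb beta p) v' =
    coef (lincomb beta p - c *: wp v) v' + c * (v == v')%:R.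
  by rewrite wcoefB wcoefZ coef_wprod subrK.
split=> // [|v' + vv'].
  rewrite fE eqxx mulr1 [X in X + _](_ : _ = 0) ?add0r //.
  by apply/eqP/negPn/negP => /Qf; rewrite word_lt_irr.
by rewrite fE [v == v']eq_sym (negbTE vv') mulr0 addr0; apply: Qf.
Qed.

Lemma leading_span (R : seq Z -> L -> Prop) f :
  (forall w g, R w g -> regular_word w /\ top P w g) ->
  (forall w g g', R w g -> R w g' -> g = g') ->
  lin_span [set g | exists w, R w g] f -> f <> 0 ->
  exists w g c, R w g /\ leading f c w.
Proof.
move=> Rtop Runiq Rf f0.
pose beta (v : word Z) : L := xget 0 [set g | R v g].
have betaE w g (rg : R w g) : exists v : word Z, wseq v = w /\ beta v = g.
  have [rw _] := Rtop _ _ rg; exists (Word rw); split=> //.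
  by rewrite /beta; case: xgetP => [g' _ /(Runiq _ _ _ rg)//|/(_ g)].
have [p fp fE] : exists2 p : word Z -> k, fin_supp p & f = lincomb beta p.
  apply: lin_span_range; move: f Rf {f0}; apply: lin_spanS => g [w /betaE[v [_ <-]]].
  by exists v.
(* Where [R] has no member, [beta] takes its default value 0, which has no top word; its coefficient
   is therefore set to 0, leaving the sum unchanged. *)
pose p' v := if `[< exists g, R v g >] then p v else 0.
have fp' : fin_supp p'.
  have [s _ sE] := fin_supp_seq fp.
  by apply: (@seq_fin_supp _ _ _ s) => v; rewrite /p' sE; case: ifP; rewrite ?eqxx.
have fE' : f = lincomb beta p'.
  have [s us sE] := fin_supp_seq fp.
  rewrite fE !(@lincombE _ _ _ _ _ s) // => [|v|v]; last 2 first.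
  - by rewrite /p' sE; case: ifP; rewrite ?eqxx.
  - by rewrite sE.
  apply: eq_bigr => v _; rewrite /p'; case: asboolP => // nR.
  by rewrite /beta; case: xgetP => [g _ /(ex_intro _ g)//|_]; rewrite !scaler0.
have betaR v : p' v != 0 -> R v (beta v).
  rewrite /p'; case: asboolP => [[g rg] _|]; last by rewrite eqxx.
  have [v' [/val_inj -> E]] := betaE _ _ rg; by rewrite E.
have [g0|/leading_exists[v [c lc]]] := EM (lincomb (fun v : word Z => wp v) p' = 0).
  case: f0; rewrite fE'; apply: (lincomb_subspace (Q := [set 0])) => //.
    by split=> [//|_ _ -> ->|e _ ->]; rewrite ?addr0 ?scaler0.
  by move=> v; rewrite -(coef_lincomb v fp') g0 wcoef0 eqxx.
exists v, (beta v), c; split.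
  by apply: betaR; case: lc => v' [/val_inj <- <- ? _]; rewrite -(coef_lincomb v' fp').
by rewrite fE'; apply: leading_lincomb lc => // v' /betaR /Rtop[].
Qed.

(** Expanding the bracket of two regular words in regular words produces only lengths at least 2. *)
Lemma coef_lie_letter f g v : size v = 1%N -> coef (lie f g) v = 0.
Proof.
pose Q : set L := [set h | forall v, size v = 1%N -> coef h v = 0].
have Qs : subspace Q.
  split=> [u _|h h' Qh Qh' u su|e h Qh u su]; first exact: wcoef0.
    by rewrite wcoefD Qh ?Qh' // addr0.
  by rewrite wcoefZ Qh ?mulr0.
have Q1 (u : seq Z) : regular_word u -> (1 < size u)%N -> Q (wp u).
  move=> ru su u' su'; rewrite (@coef_wprod _ _ _ (Word ru)).
  by case: eqP => // E; rewrite -E /= in su'; rewrite su' in su.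
have [Q0 QD QZ] := Qs.
have Qwl (u : word Z) c : Q (lie (wp u) (x_ c)).
  have ru := wseqP u; have [su|su] := ltnP 1 (size u).
    have Qi := Q1 _ (regular_insw c ru su) _.
    have si : (1 < size (insw u c))%N by rewrite size_insw ?(ltnW su) // ltnW.
    case: (lie_wprod_letter k c ru su) => [->|[u' [ru' _ pu ->]]]; first exact: Qi.
    by apply: (subspaceB Qs); [exact: Qi | apply: Q1 => //; rewrite (perm_size pu)].
  case: u su ru => -[|b [|//]] //= r _ _; change (wp [:: b]) with (x_ b).
  have [->//|[e [u' [su' _ ->]]]] := lie_letters_homog k P b c.
  by apply/QZ/Q1; [exact: wseqP | rewrite su'].
move=> sv; move: v sv; change (Q (lie f g)).
apply: (word_subspace (Q := [set f | Q (lie f g)])) => [|u _]; first exact: lie_subspace_l.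
apply: (word_subspace (Q := [set g | Q (lie (wp u) g)])) => [|u' _] /=.
  exact: lie_subspace_r.
case: u' => -[|c [|c1 u']] // r'; first exact: Qwl.
case: u => -[|b [|b1 u]] // r; last by rewrite lie_der1 //; apply: lnprod_der1.
have [_ _ QZ'] := Qs.
by rewrite lieC -scaleN1r; apply: QZ'; apply: (Qwl (Word r')).
Qed.

End Triangular.

(** * The order on the letters is well-founded *)

Section WellOrder.

Lemma well_order_wf (d : Order.disp_t) (T : orderType d) :
  well_order (<=%O : rel T) -> well_founded (fun a b : T => (a < b)%O).
Proof.
move=> wo x; apply: contrapT => nx.
have [] := wo [pred y | `[< ~ Acc (fun a b : T => (a < b)%O) y >]].
  by exists x; apply/asboolP.
move=> z [[/asboolP nz zmin] _]; apply: nz; constructor=> y yz.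
apply: contrapT => ny; have : (z <= y)%O by apply: zmin; apply/asboolP.
by rewrite leNgt yz.
Qed.

Variables (dH dI dJ : Order.disp_t).
Variables (H : orderType dH) (I : orderType dI) (J : orderType dJ).
Local Notation letter := (letter H I J).

Lemma ltLx (x x' : H) : ((Lx x : letter) < Lx x')%O = (x < x')%O.
Proof. by rewrite !lt_leAnge. Qed.
Lemma ltLa (i i' : I) : ((La i : letter) < La i')%O = (i < i')%O.
Proof. by rewrite !lt_leAnge. Qed.
Lemma ltLb (j j' : J) : ((Lb j : letter) < Lb j')%O = (j < j')%O.
Proof. by rewrite !lt_leAnge. Qed.

Lemma letter_wf : well_order (<=%O : rel H) -> well_order (<=%O : rel I) ->
  well_order (<=%O : rel J) -> well_founded (fun a b : letter => (a < b)%O).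
Proof.
move=> /well_order_wf wH /well_order_wf wI /well_order_wf wJ.
pose A := Acc (fun a b : letter => (a < b)%O).
have Ab j : A (Lb j).
  elim/(well_founded_ind wJ): j => j IH.
  constructor=> -[x|i|j'] lt; [case: (notF lt) | case: (notF lt) |].
  by apply: IH; rewrite -ltLb.
have Aa i : A (La i).
  elim/(well_founded_ind wI): i => i IH.
  constructor=> -[x|i'|j'] lt; [case: (notF lt) | | exact: Ab].
  by apply: IH; rewrite -ltLa.
case=> [x|i|j]; [|exact: Aa|exact: Ab].
elim/(well_founded_ind wH): x => x IH.
constructor=> -[x'|i'|j'] lt; [|exact: Aa|exact: Ab].
by apply: IH; rewrite -ltLx.
Qed.

End WellOrder.

(** The [A]s will be the Jacobi terms in the free algebra, the [t]s the lifts of those in A, and the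
    [D]s the errors made by lifting a product of A after, instead of before, multiplying by a
    letter. *)
Lemma zmod_jacobi (V : zmodType) (A1 A2 A3 t1 t2 t3 D1 D2 D3 : V) :
  A1 + A2 + A3 = 0 -> t1 + t2 + t3 = 0 ->
  A1 - (D1 + t1) = - (A3 - (D3 + t3)) - (A2 - (D2 + t2)) - (D1 + D2 + D3).
Proof.
rewrite -!addrA => /eqP; rewrite addr_eq0 => /eqP -> /eqP; rewrite addr_eq0 => /eqP ->.
rewrite !opprD !opprK [RHS]addrA [X in _ = X + _]addrACA [(D3 + t3) + _]addrACA.
rewrite -[RHS]addrA [- A2 - A3]addrC; congr (_ + _).
rewrite [- D1 + (- D2 - D3)]addrC [RHS]addrACA -opprD (addrC D2) subrr add0r.
by rewrite addrC (addrC t2).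
Qed.

(** * The triangular family, its span as an ideal, and its leading words *)

Section Relators.
Variables (k : fieldType) (dH dI dJ : Order.disp_t).
Variables (H : orderType dH) (I : orderType dI) (J : orderType dJ).
Variables (A : lieAlgType k) (a : I -> A) (b : J -> A).
Hypothesis A_metabelian : metabelian A.
Hypothesis a_basis : is_basis (derived 1 : set A) a.

Local Notation letter := (letter H I J).
Local Notation L := (free_metab k letter).
Local Notation x_ := (@gen k letter).
Local Notation wp := (@wprod k _ letter).
Local Notation isx := (@is_x _ _ _ H I J).
Implicit Types (f g h : L) (u w cs : seq letter) (z c y e : letter) (s t : A).

Lemma derived1_subspace : subspace (derived 1 : set A).
Proof. exact: lin_span_subspace. Qed.

Lemma derived1_lie s t : derived 1 (lie s t).
Proof. by apply: lin_span_gen; exists s, t. Qed.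

Lemma lie_derived1 s t : derived 1 s -> derived 1 t -> lie s t = 0.
Proof.
move=> ds dt; have : derived 2 (lie s t) by apply: lin_span_gen; exists s, t.
by rewrite A_metabelian.
Qed.

Definition iota_A z : A := match z with Lx _ => 0 | La i => a i | Lb j => b j end.

(* Only meaningful on the derived algebra of [A], where it is linear. *)
Definition theta s : L := lincomb (fun i => x_ (La i)) (coords a s).

Lemma a_derived1 i : derived 1 (a i).
Proof. by case: a_basis => _ <-; apply: lin_span_gen; exists i. Qed.

Lemma theta_coords s : derived 1 s -> fin_supp (coords a s) /\ s = lincomb a (coords a s).
Proof. by case: a_basis => _ <-; apply: coordsP. Qed.

Lemma theta_lincomb (p : I -> k) : fin_supp p ->
  theta (lincomb a p) = lincomb (fun i => x_ (La i)) p.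
Proof.
move=> fp; have ds : derived 1 (lincomb a p).
  by apply: lincomb_subspace derived1_subspace fp _ => i _; apply: a_derived1.
have [fq E] := theta_coords ds; congr (lincomb _ _); apply/funext => i.
have [fN EN] := lincomb_scale a (-1) fp.
have [fD ED] := lincomb_add a fq fN.
have [ind _] := a_basis; have := ind _ fD.
rewrite ED -E EN scaleN1r subrr => /(_ erefl i) /eqP.
by rewrite mulN1r subr_eq0 => /eqP.
Qed.

Lemma thetaD s t : derived 1 s -> derived 1 t -> theta (s + t) = theta s + theta t.
Proof.
move=> /theta_coords[fs {1}->] /theta_coords[ft {1}->].
have [fst <-] := lincomb_add a fs ft; rewrite theta_lincomb //.
by have [_ ->] := lincomb_add (fun i => x_ (La i)) fs ft.
Qed.

Lemma thetaZ (e : k) s : derived 1 s -> theta (e *: s) = e *: theta s.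
Proof.
move=> /theta_coords[fs {1}->]; have [fes <-] := lincomb_scale a e fs.
by rewrite theta_lincomb //; have [_ ->] := lincomb_scale (fun i => x_ (La i)) e fs.
Qed.

Lemma theta0 : theta 0 = 0.
Proof. by have [d0 _ _] := derived1_subspace; rewrite -(scale0r 0) thetaZ // scale0r. Qed.

Lemma thetaN s : derived 1 s -> theta (- s) = - theta s.
Proof. by move=> ds; rewrite -scaleN1r thetaZ // scaleN1r. Qed.

Lemma theta_a i : theta (a i) = x_ (La i).
Proof.
have [fd <-] := lincomb_delta a i; rewrite theta_lincomb //.
by have [_ ->] := lincomb_delta (fun i => x_ (La i)) i.
Qed.

Lemma theta_ind (Q : set L) s : subspace Q -> derived 1 s ->
  (forall i, Q (x_ (La i))) -> Q (theta s).
Proof. by move=> Qs /theta_coords[fs _] Qx; apply: lincomb_subspace. Qed.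

(** One antisymmetric expression for the three families of [mult_table]: on two letters a_i the
    product in A vanishes, A being metabelian. *)
Definition mrel y0 y1 : L := lie (x_ y0) (x_ y1) - theta (lie (iota_A y0) (iota_A y1)).

Lemma mrelC y0 y1 : mrel y0 y1 = - mrel y1 y0.
Proof.
rewrite /mrel opprB [lie (iota_A y0) _]lieC thetaN; last exact: derived1_lie.
by rewrite opprK lieC addrC.
Qed.

Lemma mrel_alt y : mrel y y = 0.
Proof. by rewrite /mrel !lie_alt theta0 subrr. Qed.

Lemma mrel_aa i i' : mrel (La i) (La i') = lie (x_ (La i)) (x_ (La i')).
Proof. by rewrite /mrel /= lie_derived1 ?theta0 ?subr0 //; apply: a_derived1. Qed.

(* Triangular generators of the ideal [Id(M)]: at most one for each leading word. *)
Inductive relator : seq letter -> L -> Prop :=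
| RelY y0 y1 u : ~~ isx y0 -> (y1 < y0)%O -> sorted <=%O (y1 :: u) ->
    relator (y0 :: y1 :: u) (lnprod (mrel y0 y1) u)
| RelA x y u i : ~~ isx y -> sorted <=%O (y :: u) -> La i \in u ->
    relator (Lx x :: y :: u) (wp (Lx x :: y :: u))
| RelX x x' i u : (x' < x)%O -> sorted <=%O (Lx x' :: u) ->
    relator (Lx x :: La i :: Lx x' :: u)
      (lnprod (lie (x_ (Lx x)) (x_ (Lx x'))) (La i :: u)).

Definition relspan : set L := lin_span [set f | exists w, relator w f].

Lemma relspan_subspace : subspace relspan.
Proof. exact: lin_span_subspace. Qed.
Lemma relspanB f g : relspan f -> relspan g -> relspan (f - g).
Proof. exact: subspaceB relspan_subspace. Qed.
Lemma relspanD f g : relspan f -> relspan g -> relspan (f + g).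
Proof. by have [_ + _] := relspan_subspace; apply. Qed.
Lemma relspanN f : relspan f -> relspan (- f).
Proof. by move=> ?; rewrite -scaleN1r; have [_ _] := relspan_subspace; apply. Qed.
Lemma relspan0 : relspan 0.
Proof. by have [] := relspan_subspace. Qed.

Lemma lnprod_relspan u : subspace [set f | relspan (lnprod f u)].
Proof.
have [r0 rD rZ] := relspan_subspace.
by split=> [|f g|e f] /=; rewrite ?lnprod0 ?lnprodD ?lnprodZ //; [apply: rD | apply: rZ].
Qed.

Lemma relator_relspan w f : relator w f -> relspan f.
Proof. by move=> r; apply: lin_span_gen; exists w. Qed.

Lemma lt_isx y z : (y < z)%O -> ~~ isx z -> ~~ isx y.
Proof. by case: y => // x; case: z. Qed.

Lemma sorted_min z cs : all (fun c => z <= c)%O cs ->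
  sorted <=%O (z :: sort <=%O cs).
Proof.
move=> zcs; rewrite /= path_min_sorted; first exact/sort_sorted/le_total.
by rewrite (perm_all _ (permEl (perm_sort _ _))).
Qed.

Lemma perm_sort_min cs : cs != [::] -> exists z cs',
  perm_eq cs (z :: cs') /\ all (fun c => z <= c)%O cs'.
Proof.
have : sorted <=%O (sort <=%O cs) by apply/sort_sorted/le_total.
have : perm_eq cs (sort <=%O cs) by rewrite perm_sym perm_sort.
case: (sort _ _) => [/perm_nilP -> //|z cs' p /(order_path_min le_trans) zcs' _].
by exists z, cs'.
Qed.

(** Indexed by the number of letters for a joint induction: [lie_a_closed n] uses [mrel_closed] up
    to n, and [mrel_closed n] uses [lie_a_closed] strictly below n. *)
Definition mrel_closed n := forall y0 y1 u, ~~ isx y0 -> ~~ isx y1 -> size u = n ->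
  relspan (lnprod (mrel y0 y1) u).

Definition lie_a_closed n := forall z c i u, size u = n -> La i \in u ->
  relspan (lnprod (lie (x_ z) (x_ c)) u).

Lemma lie_aC z c u :
  relspan (lnprod (lie (x_ z) (x_ c)) u) -> relspan (lnprod (lie (x_ c) (x_ z)) u).
Proof. by move=> r; rewrite lieC lnprodN; apply: relspanN. Qed.

Lemma lie_swap3 z c e u : lnprod (lie (x_ z) (x_ c)) (e :: u) =
  lnprod (lie (x_ z) (x_ e)) (c :: u) - lnprod (lie (x_ c) (x_ e)) (z :: u).
Proof. by rewrite !lnprod_cons -lnprodB -lieAC. Qed.

Lemma lie_xx_min x x' i u : (x' < x)%O -> all (fun c => Lx x' <= c)%O u ->
  relspan (lnprod (lie (x_ (Lx x)) (x_ (Lx x'))) (La i :: u)).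
Proof.
move=> x'x x'u; rewrite (lnprod_perm _ _ (_ : perm_eq _ (La i :: sort <=%O u))).
  by apply: relator_relspan (RelX _ x'x _); apply: sorted_min.
by rewrite perm_cons perm_sym perm_sort.
Qed.

Lemma lie_xy_min x y i u : ~~ isx y -> La i \in u -> all (fun c => y <= c)%O u ->
  relspan (lnprod (lie (x_ (Lx x)) (x_ y)) u).
Proof.
move=> yY iu yu; rewrite (lnprod_perm _ _ (_ : perm_eq _ (sort <=%O u))).
  by apply: (relator_relspan (RelA (i := i) _ yY _ _)); [apply: sorted_min | rewrite mem_sort].
by rewrite perm_sym perm_sort.
Qed.

(** Brackets of two letters of Y are replaced by their product in A. Brackets involving X are
    rewritten by Jacobi until the smallest suitable letter stands second, where a relator
    applies. *)
Lemma lie_a_closedP n : (forall m, (m <= n)%N -> mrel_closed m) -> lie_a_closed n.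
Proof.
move=> hM; have yy y y' i u : ~~ isx y -> ~~ isx y' -> size u = n -> La i \in u ->
    relspan (lnprod (lie (x_ y) (x_ y')) u).
  move=> yY y'Y su iu; rewrite (lnprod_perm _ _ (perm_to_rem iu)).
  set u' := rem _ u; have su' : size (La i :: u') = n by rewrite -(perm_size (perm_to_rem iu)).
  rewrite -[lie (x_ y) _](subrK (theta (lie (iota_A y) (iota_A y')))) lnprodD.
  apply: relspanD; first exact: (hM n).
  (* The product in A is a combination of letters a_l, and a_l a_i is itself a relation, followed by
     one letter fewer. *)
  apply: (theta_ind (Q := [set f | relspan (lnprod f (La i :: u'))])).
  - exact: lnprod_relspan.
  - exact: derived1_lie.
  - move=> l /=; rewrite -mrel_aa; apply: (hM (size u')) => //.
    by rewrite -su' leqnSn.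
have xy x y i u : ~~ isx y -> size u = n -> La i \in u ->
    relspan (lnprod (lie (x_ (Lx x)) (x_ y)) u).
  move=> yY su iu; have [|e [u' [p eu']]] := @perm_sort_min u; first by case: (u) iu.
  rewrite (lnprod_perm _ _ p); have iu' : La i \in e :: u' by rewrite -(perm_mem p).
  have su' : size (e :: u') = n by rewrite -(perm_size p).
  have [ye|ey] := leP y e.
    by apply: (@lie_xy_min _ _ i) => //=; rewrite ye (sub_all _ eu') // => c; apply: le_trans.
  have eY := lt_isx ey yY.
  have eyu' : all (fun c => e <= c)%O (y :: u') by rewrite /= ltW.
  rewrite lie_swap3; have [iu''|iNu'] := boolP (La i \in u').
    apply: relspanB; first by apply: (@lie_xy_min _ _ i); rewrite // inE iu'' orbT.
    by apply: (yy _ _ i); rewrite // inE iu'' orbT.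
  (* The exchange removes the only known a_i from the tail. But y > a_i within Y forces y to be some
     a_i', which takes over that role in the first term, while the second starts with the relation
     a_i' a_i. *)
  have ei : e = La i by move: iu'; rewrite inE (negbTE iNu') orbF => /eqP.
  have [i' yi'] : exists i', y = La i' by move: yY ey; rewrite ei; case: (y) => // i' _ _; exists i'.
  apply: relspanB; first by apply: (@lie_xy_min _ _ i'); rewrite // yi' mem_head.
  by rewrite yi' ei -mrel_aa; apply: (hM n).
have yz y z i u : ~~ isx y -> size u = n -> La i \in u ->
    relspan (lnprod (lie (x_ y) (x_ z)) u).
  move=> yY su iu; case: (boolP (isx z)) => [|zY]; last exact: yy zY su iu.
  by case: z => // x _; apply/lie_aC/(xy _ _ i).
move=> z c i u su iu.
case: (boolP (isx z)) => [|zY]; last exact: yz iu.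
case: (boolP (isx c)) => [|cY]; last by move=> _; apply/lie_aC; apply: yz iu.
case: c => // x' _; case: z => // x _.
have p := perm_to_rem iu; rewrite (lnprod_perm _ _ p); set u' := rem _ u in p *.
have su' : (size u').+1 = n by rewrite -su (perm_size p).
(* A further letter y of Y reduces to the previous case, by x x' y = x y x' - x' y x with a_i still
   behind. *)
have [/hasP[y yu' yY]|xu'] := boolP (has (predC isx) u').
  have p' := perm_to_rem yu'; rewrite (lnprod_perm _ _ (_ : perm_eq _ (y :: La i :: rem y u'))).
    have su'' : size (rem y u') = n.-2 by rewrite -su' (perm_size p').
    have sn : (n.-2.+2)%N = n by rewrite -su' (perm_size p').
    rewrite lie_swap3; apply: relspanB; apply: (xy _ _ i) => //=; rewrite ?su'' ?sn //.
      by rewrite !inE eqxx orbT.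
    by rewrite !inE eqxx orbT.
  rewrite (perm_trans (_ : perm_eq _ (La i :: y :: rem y u'))) ?perm_cons //.
  by rewrite -(cat1s (La i)) -(cat1s y) perm_catCA.
have main x1 x2 v : (x2 < x1)%O -> perm_eq v u' ->
    relspan (lnprod (lie (x_ (Lx x1)) (x_ (Lx x2))) (La i :: v)).
  move=> x21 pv; have [v0|] := eqVneq v [::].
    by rewrite v0; apply: lie_xx_min.
  case/perm_sort_min => e [v' [pe ev']].
  rewrite (lnprod_perm _ _ (_ : perm_eq _ (La i :: e :: v'))); last by rewrite perm_cons.
  have [|] := leP (Lx x2) e.
    move=> x2e; apply: lie_xx_min => //=; rewrite x2e /=.
    by apply: sub_all ev' => c'; apply: le_trans.
  (* All letters besides a_i are from X. As e < x2 < x1, the identity x1 x2 e = x1 e x2 - x2 e x1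
     puts the smallest letter second in both terms. *)
  have eX : isx e.
    have : e \in u' by rewrite -(perm_mem pv) (perm_mem pe) mem_head.
    by move: xu' => /hasPn h /h /=; rewrite negbK.
  case: e eX pe ev' => // x3 _ pe ev'; rewrite ltLx => x32.
  rewrite (lnprod_perm _ _ (_ : perm_eq _ (Lx x3 :: La i :: v'))); last first.
    by rewrite -(cat1s (La i)) -(cat1s (Lx x3)) perm_catCA.
  have sw c' : perm_eq (c' :: La i :: v') (La i :: c' :: v').
    by rewrite -(cat1s (La i)) -(cat1s c') perm_catCA.
  rewrite lie_swap3 !(lnprod_perm _ _ (sw _)).
  have x31 := lt_trans x32 x21.
  by apply: relspanB; apply: lie_xx_min => //=; rewrite ev' andbT ltW // ltLx.
case: (ltgtP x x') => [xx'|x'x|->]; [apply: lie_aC|..]; try exact: main.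
by rewrite lie_alt lnprod0; exact: relspan0.
Qed.

(** Only the linear part [theta] is sensitive to the order: if a_i is followed first by c in one
    product and by c' in the other, they differ by [c,c'] a_i times the remaining letters, with n -
    1 letters after the bracket. *)
Lemma mrel_perm n y0 y1 u u' : (forall m, (m < n)%N -> lie_a_closed m) ->
  size u = n -> perm_eq u u' ->
  relspan (lnprod (mrel y0 y1) u - lnprod (mrel y0 y1) u').
Proof.
move=> hA su uu'; rewrite /mrel !lnprodB (lnprod_perm _ _ uu').
rewrite opprB addrC addrA subrK.
have Qs : subspace [set f | relspan (lnprod f u' - lnprod f u)].
  split=> [|f g|e f] /=; first by rewrite !lnprod0 subrr; apply: relspan0.
    by rewrite !lnprodD opprD addrACA; apply: relspanD.
  by rewrite !lnprodZ -scalerBr; have [_ _] := relspan_subspace; apply.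
apply: (theta_ind Qs); first exact: derived1_lie.
move=> i /=; case: u u' su uu' {Qs} => [|c u] [|c' u'] su uu'.
- by rewrite subrr; apply: relspan0.
- by have := perm_size uu'.
- by have := perm_size uu'.
have [E|cc'] := eqVneq c c'.
  rewrite E perm_cons in uu' *.
  by rewrite !lnprod_cons (lnprod_perm _ _ uu') subrr; apply: relspan0.
have cu' : c \in u'.
  by have := perm_mem uu' c; rewrite mem_head inE (negbTE cc') => /esym.
have p' := perm_to_rem cu'; set t := rem c u' in p'.
have p : perm_eq u (c' :: t).
  rewrite -(perm_cons c) (perm_trans uu') //.
  rewrite (perm_trans (_ : perm_eq _ (c' :: c :: t))) ?perm_cons //.
  by rewrite -(cat1s c') -(cat1s c) perm_catCA.
rewrite !lnprod_cons (lnprod_perm _ _ p) (lnprod_perm _ _ p') !lnprod_cons.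
rewrite -lnprodB -opprB lieAC addrAC subrr sub0r opprK.
rewrite -lnprod_cons; apply: (hA (size t).+1) => //; last exact: mem_head.
by rewrite -su /= (perm_size p).
Qed.

Lemma mrel_min n y0 y1 u : (forall m, (m < n)%N -> lie_a_closed m) ->
  size u = n -> ~~ isx y0 -> (y1 < y0)%O -> all (fun c => y1 <= c)%O u ->
  relspan (lnprod (mrel y0 y1) u).
Proof.
move=> hA su y0Y y10 y1u; rewrite -[lnprod _ u](subrK (lnprod (mrel y0 y1) (sort <=%O u))).
apply: relspanD; first by apply: (mrel_perm _ _ hA) => //; rewrite perm_sym perm_sort.
by apply/relator_relspan/RelY => //; apply: sorted_min.
Qed.

(** For s = a_i the expression is m(a_i, y), and it is linear in s on the derived algebra. *)
Lemma theta_lie n s y u : mrel_closed n -> ~~ isx y -> size u = n -> derived 1 s ->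
  relspan (lnprod (lie (theta s) (x_ y) - theta (lie s (iota_A y))) u).
Proof.
move=> hM yY su ds; have [fs sE] := theta_coords ds.
pose Q : set A := [set s | derived 1 s /\
  relspan (lnprod (lie (theta s) (x_ y) - theta (lie s (iota_A y))) u)].
suff [] : Q s by [].
rewrite sE; apply: (lincomb_subspace (Q := Q)) => // [|i _].
  have [d0 dD dZ] := derived1_subspace; have dl := derived1_lie.
  split=> [|r r' [dr Qr] [dr' Qr']|e r [dr Qr]]; (split; first by [exact: d0|exact: dD|exact: dZ]).
  - by rewrite lie0l theta0 lie0l subrr lnprod0; apply: relspan0.
  - rewrite lieDl !thetaD // lieDl opprD addrACA lnprodD.
    exact: relspanD.
  - rewrite lieZl !thetaZ // lieZl -scalerBr lnprodZ.
    by have [_ _] := relspan_subspace; apply.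
split; first exact: a_derived1.
by rewrite theta_a; apply: hM.
Qed.

(** If [y1] is the smallest letter after [y0], sorting yields a relator; otherwise the smaller
    letter [c] has to be brought to second place. *)
Lemma mrel_closedP n : mrel_closed n.
Proof.
elim/ltn_ind: n => n IH.
have hA m : (m < n)%N -> lie_a_closed m.
  by move=> mn; apply: lie_a_closedP => m' mm'; apply/IH/(leq_ltn_trans mm').
suff main y0 y1 u : ~~ isx y0 -> (y1 < y0)%O -> size u = n ->
    relspan (lnprod (mrel y0 y1) u).
  move=> y0 y1 u y0Y y1Y su; case: (ltgtP y0 y1) => [lt|lt|->]; last first.
  - by rewrite mrel_alt lnprod0; apply: relspan0.
  - exact: main.
  - by rewrite mrelC lnprodN; apply/relspanN/main.
move=> y0Y y10 su; have [u0|] := eqVneq u [::].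
  by apply: (mrel_min hA); rewrite // u0.
case/perm_sort_min=> c [u' [p cu']].
rewrite -[lnprod _ u](subrK (lnprod (mrel y0 y1) (c :: u'))).
apply: relspanD; first exact: (mrel_perm _ _ hA).
have scu : size (c :: u') = n by rewrite -(perm_size p).
have [y1c|cy1] := leP y1 c.
  apply: (mrel_min (u := c :: u') hA) => //=; rewrite y1c; apply: sub_all cu' => e; exact: le_trans.
have y1Y := lt_isx y10 y0Y; have cY := lt_isx cy1 y1Y.
have cy0 := lt_trans cy1 y10.
have su' : (size u' < n)%N by rewrite -scu.
(* The Jacobi identities in [L] and in [A] rewrite [m(y0,y1) c] in terms of
   [m(y1,c) y0] and [m(y0,c) y1], modulo relations of lower degree. *)
pose D s y := lie (theta s) (x_ y) - theta (lie s (iota_A y)).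
have jac : lie (mrel y0 y1) (x_ c) = lie (mrel y0 c) (x_ y1) - lie (mrel y1 c) (x_ y0)
    - (D (lie (iota_A y0) (iota_A y1)) c + D (lie (iota_A y1) (iota_A c)) y0
       + D (lie (iota_A c) (iota_A y0)) y1).
  have d1 := derived1_lie; have [_ dD _] := derived1_subspace.
  have jA : theta (lie (lie (iota_A y0) (iota_A y1)) (iota_A c))
      + theta (lie (lie (iota_A y1) (iota_A c)) (iota_A y0))
      + theta (lie (lie (iota_A c) (iota_A y0)) (iota_A y1)) = 0.
    by rewrite -thetaD // -thetaD ?lie_jacobi ?theta0 //; apply: dD.
  have jL := lie_jacobi (x_ y0) (x_ y1) (x_ c).
  rewrite [mrel y0 c]mrelC lieNl /mrel !lieBl.
  have thD s y : lie (theta s) (x_ y) = D s y + theta (lie s (iota_A y)).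
    by rewrite /D subrK.
  rewrite !thD; exact: zmod_jacobi jL jA.
rewrite lnprod_cons jac 2!lnprodB.
have th s y : ~~ isx y -> derived 1 s -> relspan (lnprod (D s y) u').
  by move=> yY ds; apply: (@theta_lie (size u')) => //; apply: IH.
apply: relspanB; first apply: relspanB.
- rewrite -lnprod_cons; apply: (mrel_min hA) => //=.
  by rewrite ltW.
- rewrite -lnprod_cons; apply: (mrel_min hA) => //=.
  by rewrite ltW.
- have [_ sD _] := lnprod_relspan u'; have dl := derived1_lie.
  exact: (sD _ _ (sD _ _ (th _ _ cY (dl _ _)) (th _ _ y0Y (dl _ _))) (th _ _ y1Y (dl _ _))).
Qed.

(** Multiplying a relator by a letter appends it to the tail, which [mrel_closed] or [lie_a_closed]
    covers for any order of the letters. *)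
Lemma relspan_ideal : lie_ideal relspan.
Proof.
have [r0 rD rZ] := relspan_subspace.
have hA n : lie_a_closed n by apply: lie_a_closedP => m _; apply: mrel_closedP.
have right f g : relspan f -> relspan (lie f g).
  (* By Jacobi the multipliers preserving the span are closed under brackets, so letters suffice. *)
  pose Q := [set g | forall f, relspan f -> relspan (lie f g)].
  move: g f; apply: (free_metab_ind (Q := Q)) => [|g h Qg Qh f rf|z f].
  - split=> [f _|g h Qg Qh f rf|e g Qg f rf]; rewrite ?lie0r ?lieDr ?lieZr //.
      by apply: rD; [apply: Qg | apply: Qh].
    by apply: rZ; apply: Qg.
  - have E : - lie (lie g h) f = lie (lie f g) h - lie (lie f h) g.
      by rewrite (lieAC f g h) addrAC subrr sub0r.
    by rewrite lieC E; apply: relspanB; [apply/Qh/Qg | apply/Qg/Qh].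
  move: f; apply: lin_span_ind => [|f [w]]; first exact/lie_subspace_l/relspan_subspace.
  case=> [y0 y1 u y0Y y10 _|x y u i yY _ iu|x x' i u _ _] /=.
  - rewrite -lnprod_rcons; apply: (mrel_closedP (n := (size u).+1)); rewrite ?size_rcons //.
    exact: lt_isx y10 y0Y.
  - change (relspan (lie (lnprod (lie (x_ (Lx x)) (x_ y)) u) (x_ z))).
    rewrite -lnprod_rcons; apply: (hA (size u).+1 _ _ i).
      by rewrite size_rcons.
    by rewrite mem_rcons inE iu orbT.
  - rewrite -[lnprod _ u]/(lnprod _ (La i :: u)) -lnprod_rcons.
    apply: (hA (size u).+2 _ _ i); first by rewrite size_rcons.
    by rewrite mem_rcons !inE eqxx orbT.
split=> // f g rf; split; first exact: right.
by rewrite lieC; apply/relspanN/right.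
Qed.

Lemma mrel_top y0 y1 : ~~ isx y0 -> (y1 < y0)%O -> top isx [:: y0; y1] (mrel y0 y1).
Proof.
move=> y0Y y10; have [l0 lD lZ] := low_subspace k isx [:: y0; y1].
change (low isx [:: y0; y1] (mrel y0 y1 - lie (x_ y0) (x_ y1))).
rewrite /mrel addrAC subrr sub0r -scaleN1r; apply: lZ.
apply: theta_ind (low_subspace k _ _) (derived1_lie _ _) _ => i.
apply: (@low_wprod _ _ _ isx (Word (isT : regular_word [:: La i]))).
by rewrite /prec /word_lt /= (negbTE y0Y) (negbTE (lt_isx y10 y0Y)).
Qed.

Lemma relator_top w f : relator w f -> regular_word w /\ top isx w f.
Proof.
case=> [y0 y1 u y0Y y10 su|x y u i yY su iu|x x' i u x'x su].
- have rw : regular_word [:: y0, y1 & u] by rewrite /regular_word y10.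
  split=> //; have r2 : regular_word [:: y0; y1] by rewrite /= y10.
  have := @top_lnprod _ _ _ isx y0 [:: y1] u _ r2 isT (mrel_top y0Y y10).
  by rewrite sorted_sort //; exact: le_trans.
- have rw : regular_word [:: Lx x, y & u].
    by rewrite /regular_word su andbT; case: (y) yY.
  by split=> //; rewrite /top /= subrr; have [] := low_subspace k isx [:: Lx x, y & u].
- have rw x1 (v : seq letter) : sorted <=%O v -> all isx v -> regular_word [:: Lx x1, La i & v].
    move=> sv xv; rewrite /= path_min_sorted //.
    by apply: sub_all xv => -[].
  have xu : all isx u.
    by apply: sub_all (order_path_min le_trans su) => -[].
  split; first by apply: rw.
  (* By Jacobi x x' a_i = x a_i x' - x' a_i x, and the last word starts with the smaller x'. *)
  rewrite /top /mkset lnprod_cons lieAC lnprodB wprod_cons2 lnprod_cons.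
  rewrite addrAC subrr sub0r -scaleN1r.
  have [l0 lD lZ] := low_subspace k isx [:: Lx x, La i, Lx x' & u]; apply: lZ.
  have -> : lnprod (lie (lie (x_ (Lx x')) (x_ (La i))) (x_ (Lx x))) u =
      wp (Lx x' :: La i :: ins (Lx x) u).
    rewrite wprod_cons2 -[LHS]lnprod_cons; apply: lnprod_perm.
    by rewrite perm_sym perm_ins.
  have ri : regular_word (Lx x' :: La i :: ins (Lx x) u).
    apply: rw; first by apply/sorted_ins/(path_sorted su).
    by rewrite (perm_all _ (perm_ins _ _)) /= xu.
  apply: (@low_wprod _ _ _ isx (Word ri)); rewrite /prec word_lt_cons /= size_ins eqxx.
  by rewrite ltLx x'x orbT count_ins eqxx.
Qed.

(** Reads a relator off its leading word, so that no word carries two of them: the first letter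
    singles out [RelY], and a letter of Y after the second place separates [RelA] from [RelX]. *)
Definition relator_value w : L :=
  if w is z :: y :: u then
    if ~~ isx z then lnprod (mrel z y) u
    else if all isx u then
      if u is x' :: u' then lnprod (lie (x_ z) (x_ x')) (y :: u') else 0
    else wp w
  else 0.

Lemma relator_valueE w f : relator w f -> f = relator_value w.
Proof.
case=> [y0 y1 u y0Y _ _|x y u i _ _ iu|x x' i u _ su] /=; first by rewrite y0Y.
  by case: ifP => // /allP /(_ _ iu).
case: ifP => // /negbT /negP []; apply: sub_all (order_path_min le_trans su).
by case.
Qed.

Lemma relspan_leading f : relspan f -> f <> 0 ->
  exists w g (c : k), relator w g /\ leading f c w.
Proof.
move=> rf f0; apply: (leading_span (P := isx) relator_top _ rf f0).
by move=> w g g' /relator_valueE -> /relator_valueE ->.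
Qed.

End Relators.

(** * The complement and the shape of the added polynomials *)

Theorem theorem3p1 (k : fieldType) (dH dI dJ : Order.disp_t)
    (H : orderType dH) (I : orderType dI) (J : orderType dJ)
    (A : lieAlgType k) (a : I -> A) (b : J -> A)
    (gamma : I -> J -> I -> k) (delta : J -> J -> I -> k)
    (wo_H : well_order (<=%O : rel H))
    (wo_I : well_order (<=%O : rel I))
    (wo_J : well_order (<=%O : rel J))
    (A_metabelian : metabelian A)
    (a_basis : is_basis (derived 1 : set A) a)
    (b_indep : lin_indep_mod (derived 1 : set A) b)
    (Y_basis : is_basis [set: A]
       (fun y : I + J => match y with inl i => a i | inr j => b j end))
    (gammaP : forall i j,
       fin_supp (gamma i j) /\ lie (a i) (b j) = lincomb a (gamma i j))
    (deltaP : forall i j, (j < i)%O ->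
       fin_supp (delta i j) /\ lie (b i) (b j) = lincomb a (delta i j)) :
  let M : set (free_metab k (letter H I J)) := mult_table gamma delta in
  exists P : set (free_metab k (letter H I J)),
    gs_complement M (M `|` P) /\
    forall f, P f ->
      [/\ x_homogeneous f, part0 f = 0 &
          exists (x : H) (y : letter H I J) (s : seq (letter H I J)) (i : I),
            [/\ leading_word f (Lx x :: y :: s), ~~ is_x y &
                strict_subword (La i) (Lx x :: y :: s)]].
Proof.
move=> M.
pose isx := @is_x _ _ _ H I J.
pose m := mrel (H := H) a b.
have mE y0 y1 : ~~ isx y0 -> (y1 < y0)%O -> M (m y0 y1).
  case: y0 y1 => [//|i|j] [//|i'|j'] // _ lt.
  - rewrite /m mrel_aa //; apply: Mult3; by rewrite -(ltLa H J).
  - have [fg gE] := gammaP i j'.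
    by rewrite /m /mrel /= gE theta_lincomb //; apply: Mult1.
  - have lt' : (j' < j)%O by rewrite -(ltLb H I).
    have [fg gE] := deltaP j j' lt'.
    by rewrite /m /mrel /= gE theta_lincomb //; apply: Mult2.
have Mm f : M f -> exists y0 y1, [/\ ~~ isx y0, (y1 < y0)%O & f = m y0 y1].
  case=> [i j|i j lt|i j lt].
  - have [fg gE] := gammaP i j.
    by exists (La i), (Lb j); rewrite /m /mrel /= gE theta_lincomb.
  - have [fg gE] := deltaP i j lt.
    by exists (Lb i), (Lb j); rewrite ltLb /m /mrel /= gE theta_lincomb.
  - by exists (La i), (La j); rewrite ltLa /m mrel_aa.
have mtop y0 y1 : ~~ isx y0 -> (y1 < y0)%O -> top isx [:: y0; y1] (m y0 y1).
  exact: mrel_top.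
have reg2 (y0 y1 : letter H I J) : (y1 < y0)%O -> regular_word [:: y0; y1].
  by move=> lt; rewrite /= lt.
(* Each element of [M] is a relator with empty tail, and the span is an ideal. *)
have IJ f : ideal_gen M f -> relspan a b f.
  apply; first exact: relspan_ideal.
  move=> g /Mm[y0 [y1 [y0Y y10 ->]]]; apply: relator_relspan.
  exact: (RelY a b (u := [::]) y0Y y10).
have Ilead f (c : k) u : ideal_gen M f -> leading f c u -> exists g, relator a b u g.
  move=> /IJ fJ lf; have f0 : f <> 0.
    by move=> f0; case: lf => v [_ fv c0 _]; move: c0; rewrite -fv f0 wcoef0 eqxx.
  have [w [g [c' [rg lf']]]] := relspan_leading a_basis fJ f0.
  by have [<- _] := leading_uniq lf' lf; exists g.
have [||f u If [c lf]|S [SC MS Sprop]] :=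
    @gs_complement_exists k _ _ isx (letter_wf wo_H wo_I wo_J) M.
- move=> f /Mm[y0 [y1 [y0Y y10 ->]]]; exists [:: y0; y1].
  by apply: top_leading (mtop _ _ y0Y y10); apply: reg2.
- move=> f /Mm[y0 [y1 [y0Y y10 ->]]]; exists (count isx [:: y0; y1]).
  by apply: top_homog (mtop _ _ y0Y y10); apply: reg2.
- by have [g] := Ilead _ _ _ If lf; case.
have MSE : M `|` (S `\` M) = S by rewrite setDUK.
exists (S `\` M); rewrite MSE; split=> // f [/Sprop[//|[If [n hf] [u lf] irr]] _].
have [g rg] := Ilead _ _ _ If lf.
have [x [y [s [i [uE yY sub]]]]] : exists (x : H) (y : letter H I J) s (i : I),
    [/\ u = Lx x :: y :: s, ~~ is_x y & strict_subword (La i) (Lx x :: y :: s)].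
  case: rg irr lf => [y0 y1 s y0Y y10 ss|x y s i yY ss is_|x x' i s x'x ss] irr lf.
  (* Excluded by irreducibility: this is also the leading word of m(y0,y1) times [s], a normal
     [M]-word because the leading word of m(y0,y1) is not a single letter. *)
  - have tm := mtop _ _ y0Y y10; have lm := top_leading (reg2 _ _ y10) tm.
    case: (irr (lnprod (m y0 y1) s) (y0 :: y1 :: s)); last by exists 1.
      apply: NormalL; [exact: mE|exact: path_sorted ss|].
      case: (s) => // c1 s' [c lc]; by have [] := leading_uniq lm lc.
    exists 1; apply: (top_leading (P := isx)).
      by rewrite /regular_word y10.
    have := @top_lnprod _ _ _ isx y0 [:: y1] s _ (reg2 _ _ y10) isT tm.
    by rewrite sorted_sort //; exact: le_trans.
  - by exists x, y, s, i; rewrite /strict_subword is_.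
  (* Here a_i stands second and is strict because the third letter x' lies below the first letter
     x. *)
  - by exists x, (La i), (Lx x' :: s), i; split=> //=; rewrite eqxx ltLx x'x orbT.
have nu : n = count isx u by case: lf => v [<- fv c0 _]; rewrite (hf v) // fv.
split; last by exists x, y, s, i; split=> //; rewrite -uE; exists 1.
- by exists n => v /hf.
(* A word of length 1 in [f] has the X-degree of [u], which is at least 1, so it is a letter of
   X. *)
apply: coef_eq0 => v; rewrite coef_part0; case: ifP => // /eqP sv.
have [//|fv] := eqVneq (coef f v) 0.
have : isx (head (Lx x) v).
  have := hf v fv; rewrite nu uE; case: (v) sv => -[|z [|//]] //= _ _.
  by case: (isx z).
(* An ideal, since brackets have no linear terms; it contains [M], whose elements have X-degree 0,
   and hence all of Id(M). *)
pose K : set (free_metab k (letter H I J)) :=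
  [set f | forall v : word (letter H I J), size v = 1%N -> isx (head (Lx x) v) -> coef f v = 0].
have KI : lie_ideal K.
  split=> [u' _ _|f1 f2 K1 K2 u' su xu|c f1 K1 u' su xu|f1 f2 _]; first exact: wcoef0.
  - by rewrite wcoefD K1 // K2 // addr0.
  - by rewrite wcoefZ K1 // mulr0.
  - by split=> u' su _; apply: coef_lie_letter.
move=> xv; apply/eqP; move: fv; rewrite (If K KI) ?eqxx //.
move=> _ /Mm[y0 [y1 [y0Y y10 ->]]] u' su xu.
apply/eqP/negPn/negP => mu.
have := top_homog (reg2 _ _ y10) (mtop _ _ y0Y y10) mu.
have y1Y := lt_isx y10 y0Y.
case: (u') su xu => -[|z [|//]] //= _ _ -> /=.
by move: y0Y y1Y; rewrite /isx => /negbTE -> /negbTE ->.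
Qed.
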